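(* There is an absolute constant $c>0$ such that for every $n$ and every convex set $K\subseteq\mathbb{R}^n$, viewing $K$ as the function $K:\mathbb{R}^n\to\{-1,1\}$, we have $\mathsf{W}^{\le 2}[K]=\mathsf{W}^{=0}[K]+\mathsf{W}^{=1}[K]+\mathsf{W}^{=2}[K]\ge c/n^2$.
   Context: $K(x)=1$ if $x\in K$ and $-1$ otherwise. For $S\in\mathbb{N}^n$ let $H_S(x)=\prod_i h_{S_i}(x_i)$ where $h_0,h_1,\dots$ are the normalized univariate Hermite polynomials, orthonormal under $N(0,1)$. The Hermite coefficients are $\tilde f(S)=\mathbf{E}_{\mathbf{g}\sim N(0,I_n)}[f(\mathbf{g})H_S(\mathbf{g})]$, $|S|=\sum_iS_i$, $\mathsf{W}^{=j}[f]=\sum_{|S|=j}\tilde f(S)^2$, $\mathsf{W}^{\le j}[f]=\sum_{|S|\le j}\tilde f(S)^2$. *)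

(* Defs.v *)
From HB Require Import structures.
From mathcomp Require Import all_boot all_order all_algebra.
From mathcomp Require Import all_classical all_reals all_analysis.
Set Implicit Arguments. Unset Strict Implicit. Unset Printing Implicit Defensive.
Import Order.TTheory GRing.Theory Num.Theory.
Local Open Scope classical_set_scope.
Local Open Scope ring_scope.

Section Defs.
Variable R : realType.

Fixpoint hermiteHe (k : nat) (x : R) : R :=
  match k with
  | 0 => 1
  | k'.+1 =>
    match k' with
    | 0 => x
    | k''.+1 => x * hermiteHe k' x - k'%:R * hermiteHe k'' x
    end
  end.

(* normalized Hermite polynomials h_k = He_k / sqrt(k!), orthonormal under N(0,1) *)
Definition hermite (k : nat) (x : R) : R := hermiteHe k x / Num.sqrt (k`!)%:R.

Definition hermiteS (n : nat) (S : 'I_n -> nat) (x : 'rV[R]_n) : R :=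
  \prod_(i < n) hermite (S i) (x 0 i).

Definition gauss_pdf (t : R) : R := normal_pdf 0 1 t.

Definition vcons (n : nat) (t : R) (y : 'rV[R]_n) : 'rV[R]_n.+1 :=
  \row_(i < n.+1) (if unlift ord0 i is Some j then y 0 j else t).

(* E_{g ~ N(0, I_n)} [f g], computed as the iterated integral over the
   coordinates with respect to the (completed) Lebesgue measure with the
   standard Gaussian density in each coordinate (N(0,I_n) is the product of
   n copies of N(0,1)). *)
Fixpoint gauss_exp (n : nat) : ('rV[R]_n -> R) -> R :=
  match n with
  | 0 => fun f => f 0
  | m.+1 => fun f =>
      (\int[@completed_lebesgue_measure R]_(t in setT)
          (gauss_exp (fun y => f (vcons t y)) * gauss_pdf t))%R
  end.

Definition hcoef (n : nat) (f : 'rV[R]_n -> R) (S : 'I_n -> nat) : R :=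
  gauss_exp (fun x => f x * hermiteS S x).

(* W^{=j}[f] = sum_{|S| = j} tilde f(S)^2.  A multi-index S with |S| = j has
   all entries <= j, so it is enumerated exactly once by the finite functions
   'I_n -> 'I_(j.+1) whose entries sum to j. *)
Definition Weq (n : nat) (f : 'rV[R]_n -> R) (j : nat) : R :=
  \sum_(S : {ffun 'I_n -> 'I_j.+1} | (\sum_(i < n) (S i : nat))%N == j)
     hcoef f (fun i => (S i : nat)) ^+ 2.

Definition Wle (n : nat) (f : 'rV[R]_n -> R) (j : nat) : R :=
  \sum_(k < j.+1) Weq f k.

Definition pm1 (n : nat) (K : set 'rV[R]_n) (x : 'rV[R]_n) : R :=
  if `[< K x >] then 1 else -1.

End Defs.

(* Main.v *)
(** Replacing K by its closure changes each iterated integral only on a set that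
is negligible coordinate by coordinate, so K may be taken closed.  Let p be its
Gaussian measure and suppose that W^{<=2} is below c/n^2; then p is close to 1/2
and every coefficient of degree 1 or 2 is O(1/n).

If some point of norm at most a small constant r is outside K, a hyperplane
v.x <= v.z <= r separates it from K, so X = r - v.x >= 0 on K.  The low-degree
information gives E[1_K X] ~ 0 and E[1_K X^2] ~ p, which contradicts
X^2 <= 64 X + exp(X) / 16.

Otherwise K contains the ball of radius r.  For l = exp(-t), the change
of variable x -> l x and exp y >= 1 + y bound the loss of measure from K to l K by
O(n t^2) + t |E[1_K (n - |x|^2)]|.  For the matching lower bound, join independent
Gaussian points x in l K and y outside l K by an arc of N rotations
x_k = a_k x + b_k y: each x_k is again Gaussian, and when the steps are shorter
than (1 - l) r some x_k lies in K but not in l K.  Hence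
P(x in l K, y notin l K) <= N (loss) + P(|x|^2 + |y|^2 > 16 n), and with
t ~ n^{-3/2}, N ~ n^2 one gets |E[1_K (n - |x|^2)]| >= c / sqrt n.  Up to the
factor sqrt 2 this is the sum of the n coefficients at 2 e_i, and Cauchy-Schwarz
concludes. *)

Require Import Defs.
From HB Require Import structures.
From mathcomp Require Import all_boot all_order all_algebra.
From mathcomp Require Import all_classical all_reals all_analysis.
From mathcomp Require Import measurable_realfun.
From mathcomp Require Import ring lra.
Set Implicit Arguments. Unset Strict Implicit. Unset Printing Implicit Defensive.
Import Order.TTheory GRing.Theory Num.Theory.
Import numFieldNormedType.Exports.
Local Open Scope classical_set_scope.
Local Open Scope ring_scope.

(** * One-dimensional Gaussian integrals *)

Section OneDim.
Variable R : realType.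
Local Notation leb := (@lebesgue_measure R).
Local Notation cleb := (@completed_lebesgue_measure R).
Local Notation pdf := (@gauss_pdf R).

(** The exponents come from one balance. Typical points of the arc have norm O(sqrt n), so its N
    steps have length about sqrt n / N, and none of them can jump over the shell between l K and K,
    of thickness about t r, once N ~ sqrt n / t. The rotation argument then makes the loss at least
    of order 1 / N ~ t / sqrt n. The second-order error n t^2 has to stay below this, which forces t
    to be a small multiple of n^{-3/2}; dividing by t leaves the 1 / sqrt n. The case distinction
    serves to make r independent of n, since a thinner shell would need more steps. A convex set can
    fail to be Borel, and linearity and monotonicity of the iterated integral require integrability.
    Hence the passage to the closure, and a growth class for the integrands that is stable under
    slicing and contains quadratic polynomials, exponentials of linear forms and the factor exp(b
    |x|^2), b <= 1/4, which a dilation creates. *)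

Lemma completed_integralE (f : R -> \bar R) : measurable_fun [set: R] f ->
  (\int[cleb]_t f t = \int[leb]_t f t)%E.
Proof.
(* The identity is measurable from the Caratheodory sigma-algebra to the Borel one and pushes the
   completed measure forward to Lebesgue measure. This settles nonnegative functions; positive and
   negative parts do the rest. *)
have mid : measurable_fun [set: caratheodory_type (wlength (@idfun R))^*%mu]
    (idfun : caratheodory_type (wlength (@idfun R))^*%mu -> measurableTypeR R).
  move=> _ B mB; rewrite setTI preimage_id.
  exact: sub_caratheodory.
have ge0case (g : R -> \bar R) : measurable_fun [set: R] g ->
    (forall t, 0 <= g t)%E -> (\int[cleb]_t g t = \int[leb]_t g t)%E.
  move=> mg g0.
  have /= h := @ge0_integral_pushforward _ _ _ (measurableTypeR R) R _ mid cleb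
    setT g measurableT mg (fun y _ => g0 y).
  rewrite preimage_setT in h.
  transitivity (\int[pushforward cleb (idfun : caratheodory_type (wlength (@idfun R))^*%mu -> measurableTypeR R)]_y g y)%E.
    exact: esym h.
  apply: eq_measure_integral => A mA _ /=.
  by rewrite /pushforward preimage_id.
move=> mf; rewrite integralE [RHS]integralE; congr (_ - _)%E; apply: ge0case => //.
- exact: measurable_funepos.
- exact: measurable_funeneg.
Qed.

(** The image of Lebesgue measure under t -> a t + c, scaled by [a], has the right value on
    half-open intervals, so it is Lebesgue measure by uniqueness. *)
Lemma ge0_integral_affine (a c : R) (f : R -> \bar R) : 0 < a ->
  measurable_fun [set: R] f -> (forall t, 0 <= f t)%E ->
  (a%:E * \int[leb]_t f (a * t + c)%R = \int[leb]_t f t)%E.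
Proof.
move=> a0 mf f0.
pose phi : measurableTypeR R -> measurableTypeR R := fun t => a * t + c.
have mphi : measurable_fun [set: measurableTypeR R] phi.
  apply: measurable_funD => //; apply: measurable_funM => //.
have h := @ge0_integral_pushforward _ _ _ _ R phi mphi leb setT f measurableT mf
  (fun y _ => f0 y).
rewrite preimage_setT in h.
rewrite -[X in (_ * X)%E]h.
pose a' : {nonneg R} := NngNum (ltW a0).
rewrite -(@ge0_integral_mscale _ _ _ _ _ _ a') //.
apply: eq_measure_integral => A mA _ /=.
apply/esym.
apply: (@lebesgue_measure_unique R (mscale a' (pushforward leb phi))) => //.
move=> _ [[u v]] _ <- /=.
rewrite /mscale /= /pushforward.
have -> : phi @^-1` `]u, v]%classic = `](u - c) / a, (v - c) / a]%classic.
  apply/seteqP; split => x; rewrite /= !in_itv /= /phi ltr_pdivrMr // ler_pdivlMr //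
    mulrC; lra.
rewrite !lebesgue_measure_itv /= !lte_fin ltr_pM2r ?invr_gt0 // ltrD2r.
case: ifP => _; last by rewrite mule0.
rewrite -!EFinD -EFinM; congr EFin; field; lra.
Qed.


Definition gauss1 (F : R -> R) : R :=
  (\int[cleb]_(t in setT) (F t * pdf t))%R.

Lemma gauss_pdfE t : pdf t = normal_peak 1 * expR (- (t ^+ 2 / 2)).
Proof.
rewrite /gauss_pdf normal_pdfE ?oner_eq0 // /normal_fun subr0 expr1n.
by congr (_ * expR _); rewrite mulNr.
Qed.

Lemma gauss_pdf_ge0 t : 0 <= pdf t.
Proof. exact: normal_pdf_ge0. Qed.

Lemma measurable_gauss_pdf : measurable_fun [set: R] pdf.
Proof. exact: measurable_normal_pdf. Qed.

Lemma gauss1E F : measurable_fun [set: R] F ->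
  gauss1 F = fine (\int[leb]_t (F t * pdf t)%:E)%E.
Proof.
move=> mF; congr fine; apply: completed_integralE.
apply/measurable_EFinP/measurable_funM => //; exact: measurable_gauss_pdf.
Qed.

Lemma integral_gauss_pdf : (\int[leb]_t (pdf t)%:E = 1)%E.
Proof. by rewrite integral_normal_pdf // oner_eq0. Qed.

(* The weight stays integrable after multiplication by the Gaussian density and
   dominates polynomials, moderate exponentials and the factor created by a
   change of scale. *)
Definition tame1 (F : R -> R) := measurable_fun [set: R] F /\
  exists M, forall t, `|F t| <= M * expR (t ^+ 2 / 4).

(** exp(t^2 / 4) times the standard density is a multiple of the density of variance 2. *)
Lemma tame1_integrable F : tame1 F ->
  leb.-integrable setT (fun t => (F t * pdf t)%:E).
Proof.
move=> [mF [M FM]].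
have s2 : Num.sqrt 2 != 0 :> R by rewrite sqrtr_eq0 -ltNge.
have p2 := normal_peak_gt0 s2.
apply: (@le_integrable _ _ _ leb setT measurableT _
  (fun t => (`|M| * (normal_peak 1 / normal_peak (Num.sqrt 2))
             * normal_pdf 0 (Num.sqrt 2) t)%:E)).
- apply/measurable_EFinP/measurable_funM => //; exact: measurable_gauss_pdf.
- move=> t _; rewrite lee_fin normrM [`|pdf t|]ger0_norm ?gauss_pdf_ge0 //.
  apply: le_trans (ler_norm _).
  apply: (@le_trans _ _ (`|M| * expR (t ^+ 2 / 4) * pdf t)).
    apply: ler_wpM2r; first exact: gauss_pdf_ge0.
    by apply: (le_trans (FM t)); rewrite ler_wpM2r ?expR_ge0 // ler_norm.
  rewrite gauss_pdfE normal_pdfE // /normal_fun subr0 sqr_sqrtr // -!mulrA.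
  apply: ler_wpM2l => //.
  rewrite [(normal_peak (Num.sqrt 2))^-1 * _]mulKf ?gt_eqF // mulrCA -expRD.
  rewrite ler_wpM2l ?normal_peak_ge0 // le_eqVlt; apply/orP; left; apply/eqP.
  congr expR; rewrite -mulr_natr; by field.
- have : leb.-integrable setT (fun t => ((`|M| * (normal_peak 1 / normal_peak (Num.sqrt 2)))%:E
             * (normal_pdf 0 (Num.sqrt 2) t)%:E)%E).
    by apply: integrableZl => //; exact: integrable_normal_pdf.
  by [].

Qed.

Lemma tame1D F G : tame1 F -> tame1 G -> tame1 (fun t => F t + G t).
Proof.
move=> [mF [M FM]] [mG [N GN]]; split; first exact: measurable_funD.
exists (M + N) => t; rewrite mulrDl; apply: le_trans (ler_normD _ _) _.
exact: lerD.
Qed.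

Lemma tame1_bd (F : R -> R) M : measurable_fun setT F -> (forall t, `|F t| <= M) -> tame1 F.
Proof.
move=> mF FM; split => //; exists M => t; apply: (le_trans (FM t)).
have M0 : 0 <= M by apply: le_trans (FM 0).
rewrite -[leLHS]mulr1 ler_wpM2l // -expR0 ler_expR.
by rewrite divr_ge0 // sqr_ge0.
Qed.

Lemma gauss1D F G : tame1 F -> tame1 G ->
  gauss1 (fun t => F t + G t) = gauss1 F + gauss1 G.
Proof.
move=> gF gG; have [mF _] := gF; have [mG _] := gG.
rewrite !gauss1E //; last exact: measurable_funD.
rewrite -fineD; last 2 first.
- exact: integrable_fin_num (tame1_integrable gF).
- exact: integrable_fin_num (tame1_integrable gG).
rewrite -integralD //; try exact: tame1_integrable.
by congr fine; apply: eq_integral => t _; rewrite mulrDl EFinD.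
Qed.

Lemma gauss1Z c F : tame1 F -> gauss1 (fun t => c * F t) = c * gauss1 F.
Proof.
move=> gF; have [mF _] := gF.
rewrite !gauss1E //; last exact: measurable_funM.
rewrite -[c in RHS]/(fine c%:E) -fineM //; last first.
  exact: integrable_fin_num (tame1_integrable gF).
rewrite -integralZl //; last exact: tame1_integrable.
by congr fine; apply: eq_integral => t _; rewrite -mulrA EFinM.
Qed.

Lemma gauss1_le F G : tame1 F -> tame1 G -> (forall t, F t <= G t) ->
  gauss1 F <= gauss1 G.
Proof.
move=> gF gG FG; have [mF _] := gF; have [mG _] := gG.
rewrite !gauss1E //; apply: fine_le.
- exact: integrable_fin_num (tame1_integrable gF).
- exact: integrable_fin_num (tame1_integrable gG).
apply: le_integral => //; try exact: tame1_integrable.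
by move=> t _; rewrite lee_fin ler_wpM2r // gauss_pdf_ge0.
Qed.

Lemma gauss1_cst c : gauss1 (fun=> c) = c.
Proof.
rewrite gauss1E //.
under eq_integral do rewrite EFinM.
rewrite integralZl //=; last by apply: integrable_normal_pdf; rewrite oner_eq0.
by rewrite integral_gauss_pdf mule1.
Qed.

Lemma gauss1_scale l (F : R -> R) : 0 < l -> measurable_fun setT F -> (forall t, 0 <= F t) ->
  gauss1 (fun t => F (t / l)) =
  l * gauss1 (fun t => F t * expR ((1 - l ^+ 2) / 2 * t ^+ 2)).
Proof.
move=> l0 mF F0.
have mFl : measurable_fun [set: R] (fun t => F (t / l)).
  by apply: measurableT_comp => //; exact: measurable_funM.
have mE : measurable_fun [set: R] (fun t => F t * expR ((1 - l ^+ 2) / 2 * t ^+ 2)).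
  apply: measurable_funM => //; apply: measurableT_comp => //.
  by apply: measurable_funM => //; exact: measurable_funX.
rewrite !gauss1E //.
rewrite -(@ge0_integral_affine l 0) //; last 2 first.
- apply/measurable_EFinP/measurable_funM => //; exact: measurable_gauss_pdf.
- by move=> t; rewrite lee_fin mulr_ge0 // gauss_pdf_ge0.
under eq_integral => t _.
  rewrite addr0 [l * t]mulrC mulfK ?gt_eqF //.
  have -> : pdf (t * l) = expR ((1 - l ^+ 2) / 2 * t ^+ 2) * pdf t.
    rewrite !gauss_pdfE mulrCA -expRD; congr (_ * expR _).
    by field.
  rewrite mulrA.
  over.
set I := (\int[leb]_t _)%E.
have : (0 <= I)%E.
  by apply: integral_ge0 => t _; rewrite lee_fin !mulr_ge0 ?expR_ge0 ?gauss_pdf_ge0.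
case: I => [x| |] //= _.
(* When the integral is infinite, [fine] sends both sides to 0, so no integrability is required. *)
by rewrite mulry gtr0_sg // mul1e /= mulr0.
Qed.

(** Rotation invariance in the plane. With u = a s + b t, the joint density of (s, u) is also the
    standard density of u times a normal density in s; after exchanging the integrals by Tonelli,
    the latter integrates to 1. *)
Lemma gauss1_conv (a b : R) (F : R -> R) M : 0 < b -> a ^+ 2 + b ^+ 2 = 1 ->
  measurable_fun setT F -> (forall t, 0 <= F t <= M) ->
  gauss1 (fun s => gauss1 (fun t => F (a * s + b * t))) = gauss1 F.
Proof.
move=> b0 ab mF FM.
have F0 t : 0 <= F t by case/andP: (FM t).
have mFs s : measurable_fun [set: R] (fun t => F (a * s + b * t)).
  apply: measurableT_comp => //.
  by apply: measurable_funD; [exact: measurable_cst|exact: measurable_funM].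
(* [F u] times the density of u = a s + b t for fixed s. *)
pose k (u s : R) := F u * (b^-1 * pdf ((u - a * s) / b)).
have k0 u s : 0 <= k u s by rewrite !mulr_ge0 ?invr_ge0 ?gauss_pdf_ge0 // ltW.
have mk2 : measurable_fun [set: R * R] (fun p => k p.1 p.2).
  apply: measurable_funM; first exact: measurableT_comp.
  apply: measurable_funM => //.
  apply: measurableT_comp; first exact: measurable_gauss_pdf.
  apply: measurable_funM => //; apply: measurable_funB => //.
  exact: measurable_funM.
have mk2s : measurable_fun [set: R * R] (fun p => k p.2 p.1).
  apply: measurable_funM; first exact: measurableT_comp.
  apply: measurable_funM => //.
  apply: measurableT_comp; first exact: measurable_gauss_pdf.
  apply: measurable_funM => //; apply: measurable_funB => //.
  exact: measurable_funM.
have mku s : measurable_fun [set: R] (fun u => k u s).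
  apply: measurable_funM => //; apply: measurable_funM => //.
  apply: measurableT_comp; first exact: measurable_gauss_pdf.
  by apply: measurable_funM => //; exact: measurable_funB.
have gs s : (\int[leb]_t (F (a * s + b * t) * pdf t)%:E =
    \int[leb]_u (k u s)%:E)%E.
  rewrite -(@ge0_integral_affine b (a * s) (fun u => (k u s)%:E)) //; last 2 first.
  - by apply/measurable_EFinP.
  - by move=> t; rewrite lee_fin.
  rewrite -ge0_integralZl //=; last 3 first.
  - apply/measurable_EFinP.
    apply: (measurableT_comp (mku s)).
    by apply: measurable_funD => //; exact: measurable_funM.
  - by move=> t _; rewrite lee_fin.
  - by rewrite lee_fin ltW.
  apply: eq_integral => t _; rewrite -EFinM /k; congr EFin.
  rewrite [a * s + _]addrC addrK [b * t]mulrC mulfK ?gt_eqF //.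
  by field; rewrite gt_eqF.
have M0 : 0 <= M by case/andP: (FM 0); exact: le_trans.
have gF s : tame1 (fun t => F (a * s + b * t)).
  by apply: (@tame1_bd _ M) => // t; rewrite ger0_norm //; case/andP: (FM (a * s + b * t)).
have mG : measurable_fun [set: R] (fun s => (\int[leb]_u (k u s)%:E)%E).
  apply: (@measurable_fun_fubini_tonelli_F _ _ _ _ R leb (fun p : R * R => (k p.2 p.1)%:E)).
  - by apply/measurable_EFinP.
  - by move=> x; rewrite lee_fin.
have gsE s : gauss1 (fun t => F (a * s + b * t)) = fine (\int[leb]_u (k u s)%:E)%E.
  by rewrite gauss1E // gs.
rewrite gauss1E; last first.
  under eq_fun do rewrite gsE.
  exact: measurableT_comp.
rewrite gauss1E //; congr fine.
transitivity (\int[leb]_s (\int[leb]_u (k u s * pdf s)%:E))%E.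
  apply: eq_integral => s _.
  rewrite gsE EFinM fineK; last first.
    by rewrite -gs; exact: integrable_fin_num (tame1_integrable (gF s)).
  rewrite muleC -ge0_integralZl //=; last 3 first.
  - by apply/measurable_EFinP; exact: mku.
  - by move=> t _; rewrite lee_fin.
  - by rewrite lee_fin gauss_pdf_ge0.
  by apply: eq_integral => u _; rewrite -EFinM mulrC.
rewrite -(@fubini_tonelli _ _ _ _ R leb leb (fun p : R * R => (k p.1 p.2 * pdf p.2)%:E)); last 2 first.
- apply/measurable_EFinP; apply: measurable_funM => //.
  by apply: measurableT_comp; first exact: measurable_gauss_pdf.
- by move=> x; rewrite lee_fin mulr_ge0 // gauss_pdf_ge0.
apply: eq_integral => u _ /=; rewrite /fubini_F /=.
under eq_integral => s _.
  (* Given u, the variable s is normal with mean a u and standard deviation b; the exponents agree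
     because a^2 + b^2 = 1. *)
  have -> : k u s * pdf s = F u * pdf u * normal_pdf (a * u) b s.
    rewrite /k !gauss_pdfE normal_pdfE ?gt_eqF // /normal_fun.
    have -> : normal_peak b = b^-1 * normal_peak 1.
      rewrite /normal_peak expr1n mul1r -mulr_natr -mulrA sqrtrM ?sqr_ge0 // sqrtr_sqr.
      by rewrite gtr0_norm // invfM mulr_natr.
    set e1 := expR (- (((u - a * s) / b) ^+ 2 / 2)).
    set e2 := expR (- (s ^+ 2 / 2)); set e3 := expR (- (u ^+ 2 / 2)).
    set e4 := expR _.
    have e1234 : e1 * e2 = e3 * e4.
      rewrite -!expRD; congr expR; rewrite -[_ *+ 2]mulr_natr.
      apply/eqP; rewrite -subr_eq0; apply/eqP.
      transitivity (- ((2 * b ^+ 2)^-1 * (a ^+ 2 + b ^+ 2 - 1) * (s ^+ 2 - u ^+ 2))).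
        by field; rewrite gt_eqF.
      by rewrite ab subrr mulr0 mul0r oppr0.
    transitivity (F u * b^-1 * normal_peak 1 * normal_peak 1 * (e1 * e2)); first by ring.
    by rewrite e1234; ring.
  rewrite EFinM.
  over.
rewrite integralZl //; last first.
  by apply: integrable_normal_pdf; rewrite gt_eqF.
by rewrite integral_normal_pdf ?gt_eqF // mule1.
Qed.

Lemma gauss1_expR v : gauss1 (fun t => expR (v * t)) = expR (v ^+ 2 / 2).
Proof.
rewrite gauss1E; last by apply: measurableT_comp => //; exact: measurable_funM.
under eq_integral => t _.
  have -> : expR (v * t) * pdf t = expR (v ^+ 2 / 2) * normal_pdf v 1 t.
    rewrite gauss_pdfE normal_pdfE ?oner_eq0 // /normal_fun expr1n.
    rewrite mulrCA [RHS]mulrCA -!expRD; congr (_ * expR _).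
    by field.
  rewrite EFinM.
  over.
rewrite integralZl //; last by apply: integrable_normal_pdf; rewrite oner_eq0.
by rewrite integral_normal_pdf ?oner_eq0 // mule1.
Qed.

Lemma expR_ge_poly4 (x : R) : 0 <= x -> (x / 4) ^+ 4 <= expR x.
Proof.
move=> x0; have -> : expR x = expR (x / 4) ^+ 4.
  by rewrite -expRM_natl; congr expR; field.
rewrite lerXn2r ?nnegrE ?expR_ge0 ?divr_ge0 //.
have := expR_ge1Dx (x / 4); lra.
Qed.

Lemma tame1_quadratic (a b c : R) : tame1 (fun t => a + b * t + c * t ^+ 2).
Proof.
split.
  apply: measurable_funD; last by apply: measurable_funM => //; exact: measurable_funX.
  by apply: measurable_funD => //; exact: measurable_funM.
exists (`|a| + `|b| + 4 * `|b| + 4 * `|c|) => t.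
have e1 := expR_ge1Dx (t ^+ 2 / 4).
have t2 : 0 <= t ^+ 2 by exact: sqr_ge0.
apply: (@le_trans _ _ ((`|a| + `|b| + 4 * `|b| + 4 * `|c|) * (1 + t ^+ 2 / 4))); last first.
  by rewrite ler_wpM2l // !addr_ge0 // mulr_ge0.
apply: le_trans (ler_normD _ _) _; rewrite normrM [`|t ^+ 2|]ger0_norm //.
apply: (@le_trans _ _ (`|a| + `|b| * `|t| + `|c| * t ^+ 2)).
  by rewrite lerD2r; apply: le_trans (ler_normD _ _) _; rewrite normrM.
have a0 := normr_ge0 a; have b0 := normr_ge0 b; have c0 := normr_ge0 c.
have t1 : `|t| <= 1 + t ^+ 2.
  by rewrite -(real_normK (num_real t)); have := normr_ge0 t; nra.
have h1 : `|b| * `|t| <= `|b| * (1 + t ^+ 2) by rewrite ler_wpM2l.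
have h2 : 0 <= `|a| * t ^+ 2 by rewrite mulr_ge0.
have h3 : 0 <= `|b| * t ^+ 2 by rewrite mulr_ge0.
lra.
Qed.

Lemma tame1_id : tame1 (fun t => t).
Proof.
have -> : (fun t : R => t) = (fun t => 0 + 1 * t + 0 * t ^+ 2); last exact: tame1_quadratic.
by apply/funext => t; ring.
Qed.

Lemma tame1_sqr : tame1 (fun t => t ^+ 2).
Proof.
have -> : (fun t : R => t ^+ 2) = (fun t => 0 + 0 * t + 1 * t ^+ 2); last exact: tame1_quadratic.
by apply/funext => t; ring.
Qed.

Lemma tame1_cst c : tame1 (fun=> c).
Proof. exact: (@tame1_bd _ `|c|). Qed.

Lemma tame1Z c F : tame1 F -> tame1 (fun t => c * F t).
Proof.
move=> [mF [M FM]]; split; first exact: measurable_funM.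
by exists (`|c| * M) => t; rewrite normrM -mulrA ler_wpM2l.
Qed.

(** From exp(v t) >= 1 + v t and the generating function, 1 + v m <= exp(v^2 / 2) <= 1 + v^2 for
    small v of either sign, so |m| is below every small positive number. *)
Lemma gauss1_id : gauss1 (fun t => t) = 0.
Proof.
set m := gauss1 _.
have h (v : R) : `|v| <= 1 / 2 -> 1 + v * m <= expR (v ^+ 2 / 2).
  move=> hv; rewrite -gauss1_expR /m -gauss1Z; last exact: tame1_id.
  rewrite -[1 in leLHS]gauss1_cst -gauss1D; last 2 first.
    exact: tame1_cst.
    exact: tame1Z tame1_id.
  apply: gauss1_le.
  - by apply: tame1D; [exact: tame1_cst|exact: tame1Z tame1_id].
  - split; first by apply: measurableT_comp => //; exact: measurable_funM.
    exists (expR (v ^+ 2)) => t; rewrite ger0_norm ?expR_ge0 // -expRD ler_expR.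
    have := sqr_ge0 (v - t / 2); lra.
  - by move=> t; exact: expR_ge1Dx.
have e (v : R) : `|v| <= 1 / 2 -> expR (v ^+ 2 / 2) <= 1 + v ^+ 2.
  rewrite ler_norml => hv; have hv2 : v ^+ 2 <= 1 / 4 by nra.
  have := expR_ge1Dx (- (v ^+ 2 / 2)); rewrite expRN => h1.
  have e0 := expR_gt0 (v ^+ 2 / 2).
  have : (1 - v ^+ 2 / 2) * expR (v ^+ 2 / 2) <= 1.
    by rewrite -ler_pdivlMr // div1r.
  have := sqr_ge0 v; nra.
have k (v : R) : `|v| <= 1 / 2 -> v * m <= v ^+ 2.
  by move=> hv; have := h v hv; have := e v hv; lra.
have m1 (v : R) : 0 < v -> v <= 1 / 2 -> `|m| <= v.
  move=> v0 v1; have hv : `|v| <= 1 / 2 by rewrite ger0_norm // ltW.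
  have := k v hv; have := k (- v); rewrite normrN => /(_ hv) k1 k2.
  rewrite ler_norml; nra.
apply/eqP; rewrite -normr_eq0 eq_le normr_ge0 andbT leNgt; apply/negP => m0.
have [h1|h1] := leP `|m| 1.
  have := m1 (`|m| / 2); lra.
have := m1 (1 / 2); lra.
Qed.

(** Scaling the constant 1 gives 1 = l E[exp((1 - l^2) t^2 / 2)] >= l (1 + (1 - l^2) m / 2). Values
    of l just below 1 bound m from above, values just above 1 bound it from below. *)
Lemma gauss1_sqr : gauss1 (fun t => t ^+ 2) = 1.
Proof.
set m := gauss1 _.
have h (l : R) : 3 / 4 < l -> l * (1 + (1 - l ^+ 2) / 2 * m) <= 1.
  move=> hl; have l0 : 0 < l by lra.
  have E : 1 = l * gauss1 (fun t => expR ((1 - l ^+ 2) / 2 * t ^+ 2)).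
    rewrite -[LHS](gauss1_cst 1).
    rewrite (@gauss1_scale l (fun=> 1)) //; congr (_ * gauss1 _).
    by apply/funext => t; rewrite mul1r.
  rewrite [leRHS]E (ler_wpM2l (ltW l0)) // /m -gauss1Z; last exact: tame1_sqr.
  rewrite -[X in X + gauss1 _]gauss1_cst -gauss1D; last 2 first.
    exact: tame1_cst.
    exact: tame1Z tame1_sqr.
  apply: gauss1_le.
  - by apply: tame1D; [exact: tame1_cst|exact: tame1Z tame1_sqr].
  - split.
      apply: measurableT_comp => //.
      by apply: measurable_funM; [exact: measurable_cst|exact: measurable_funX].
    exists 1 => t; rewrite mul1r ger0_norm ?expR_ge0 // ler_expR.
    have : 0 <= (l ^+ 2 - 1 / 2) * t ^+ 2 by rewrite mulr_ge0 ?sqr_ge0 //; nra.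
    lra.
  - by move=> t; exact: expR_ge1Dx.
have m0 : 0 <= m.
  rewrite -[leLHS](gauss1_cst 0); apply: gauss1_le; [exact: tame1_cst|exact: tame1_sqr|].
  by move=> t; exact: sqr_ge0.
apply/eqP; rewrite eq_le; apply/andP; split; rewrite leNgt; apply/negP => m1.
(* The excess of m over 1, truncated at 1 so that l = 1 - u / 8 stays above 3 / 4. *)
- have [u [u0 u1 um]] : exists u : R, [/\ 0 < u, u <= 1 & 1 + u <= m].
    have [hm|hm] := leP m 2; first by exists (m - 1); split; lra.
    by exists 1; split; lra.
  have := h (1 - u / 8).
  have : (1 - u / 8) * (2 - u / 8) * (1 + u) <= (1 - u / 8) * (2 - u / 8) * m.
    by rewrite ler_wpM2l // mulr_ge0; lra.
  move=> h1 h2; have {h2} : 3 / 4 < 1 - u / 8 by lra.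
  move=> /h h2.
  have : u / 8 * ((1 - u / 8) * (2 - u / 8) * m / 2 - 1) <= 0 by lra.
  rewrite pmulr_rle0; last lra.
  nra.
- have [u [u0 u1 um]] : exists u : R, [/\ 0 < u, u <= 1 & m = 1 - u].
    by exists (1 - m); split; lra.
  have : 3 / 4 < 1 + u / 4 by lra.
  move=> /h h2; subst m; rewrite um in h2.
  have : u / 4 * (1 - (1 + u / 4) * (2 + u / 4) * (1 - u) / 2) <= 0 by lra.
  rewrite pmulr_rle0; last lra.
  nra.
Qed.

End OneDim.

(** * Parametrized measurability and iterated integrals *)

Section NDim.
Variable R : realType.
Local Notation leb := (@lebesgue_measure R).
Local Notation pdf := (@gauss_pdf R).
Local Notation rV n := 'rV[R]_n.

Definition vtail n (x : rV n.+1) : rV n := \row_j x 0 (lift ord0 j).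

Lemma vcons0 n t (y : rV n) : vcons t y 0 ord0 = t.
Proof. by rewrite mxE unlift_none. Qed.

Lemma vconsS n t (y : rV n) j : vcons t y 0 (lift ord0 j) = y 0 j.
Proof. by rewrite mxE liftK. Qed.

Lemma vtail_vcons n t (y : rV n) : vtail (vcons t y) = y.
Proof. by apply/rowP => j; rewrite mxE vconsS. Qed.

Lemma vcons_eta n (x : rV n.+1) : vcons (x 0 ord0) (vtail x) = x.
Proof.
apply/rowP => i; case: (unliftP ord0 i) => [j ->|->]; last by rewrite vcons0.
by rewrite vconsS mxE.
Qed.

Lemma vconsZ n a t (y : rV n) : a *: vcons t y = vcons (a * t) (a *: y).
Proof.
apply/rowP => i; case: (unliftP ord0 i) => [j ->|->].
  by rewrite vconsS !mxE liftK.
by rewrite vcons0 !mxE unlift_none.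
Qed.

Lemma vconsD n s t (x y : rV n) : vcons s x + vcons t y = vcons (s + t) (x + y).
Proof.
apply/rowP => i; case: (unliftP ord0 i) => [j ->|->].
  by rewrite vconsS !mxE liftK.
by rewrite vcons0 !mxE unlift_none.
Qed.

Definition sqn n (x : rV n) : R := \sum_(i < n) x 0 i ^+ 2.

Lemma sqn_vcons n t (y : rV n) : sqn (vcons t y) = t ^+ 2 + sqn y.
Proof.
by rewrite /sqn big_ord_recl vcons0; congr (_ + _); apply: eq_bigr => i _; rewrite vconsS.
Qed.

Lemma sqn_ge0 n (x : rV n) : 0 <= sqn x.
Proof. by apply: sumr_ge0 => i _; exact: sqr_ge0. Qed.

Lemma gauss_expS n (f : rV n.+1 -> R) :
  gauss_exp f = gauss1 (fun t => gauss_exp (fun y => f (vcons t y))).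
Proof. by []. Qed.

(* Joint Borel measurability in a parameter and in the coordinates, with the
   coordinates absorbed one at a time into the parameter space, so that no
   sigma-algebra on row vectors is needed. *)
Fixpoint pmeas (n : nat) : forall d (T : measurableType d), (T -> rV n -> R) -> Prop :=
  match n return forall d (T : measurableType d), (T -> rV n -> R) -> Prop with
  | 0 => fun d T f => measurable_fun [set: T] (fun s => f s 0)
  | m.+1 => fun d T f =>
      @pmeas m _ (T * R)%type (fun s y => f s.1 (vcons s.2 y))
  end.

Lemma pmeas_op (phi : R * R -> R) : measurable_fun setT phi ->
  forall n d (T : measurableType d) (f g : T -> rV n -> R),
  pmeas f -> pmeas g -> pmeas (fun s x => phi (f s x, g s x)).
Proof.
move=> mphi; elim=> [|n IH] d T f g /=; last exact: IH.
move=> mf mg; apply: (measurableT_comp mphi); exact: measurable_fun_pair.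
Qed.

Lemma pmeas_pre n d d' (T : measurableType d) (T' : measurableType d')
    (h : T' -> T) (f : T -> rV n -> R) :
  measurable_fun setT h -> pmeas f -> pmeas (fun s x => f (h s) x).
Proof.
move=> mh; elim: n d d' T T' h f mh => [|n IH] d d' T T' h f mh /= mf.
  exact: (measurableT_comp mf mh).
apply: (IH _ _ _ _ (fun s : T' * R => (h s.1, s.2)) (fun s y => f s.1 (vcons s.2 y))) => //.
apply: measurable_fun_pair => //; exact: measurableT_comp.
Qed.

Lemma pmeas_par n d (T : measurableType d) (h : T -> R) :
  measurable_fun setT h -> pmeas (fun s (x : rV n) => h s).
Proof.
elim: n d T h => [|n IH] d T h mh //=.
apply: (IH _ _ (fun s : T * R => h s.1)); exact: measurableT_comp.
Qed.

Lemma pmeas_coord n d (T : measurableType d) i : pmeas (fun (s : T) (x : rV n) => x 0 i).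
Proof.
elim: n d T i => [|n IH] d T i /=; first by case: i.
case: (unliftP ord0 i) => [j ->|->].
  have -> : (fun (s : T * R) (y : rV n) => vcons s.2 y 0 (lift ord0 j)) = fun s y => y 0 j.
    by apply/funext => s; apply/funext => y; rewrite vconsS.
  exact: IH.
have -> : (fun (s : T * R) (y : rV n) => vcons s.2 y 0 ord0) = fun s y => s.2.
  by apply/funext => s; apply/funext => y; rewrite vcons0.
exact: pmeas_par.
Qed.

Lemma pmeas_lim n d (T : measurableType d) (F : nat -> T -> rV n -> R) (f : T -> rV n -> R) :
  (forall k, pmeas (F k)) -> (forall s x, F k s x @[k --> \oo] --> f s x) -> pmeas f.
Proof.
elim: n d T F f => [|n IH] d T F f mF Ff /=.
  by apply: (measurable_fun_cvg mF) => s _; exact: Ff.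
exact: (IH _ _ (fun k s y => F k s.1 (vcons s.2 y))).
Qed.

Lemma pmeas_scale n d (T : measurableType d) (f : T -> rV n -> R) (a : R) :
  pmeas f -> pmeas (fun s x => f s (a *: x)).
Proof.
elim: n d T f => [|n IH] d T f /= mf; first by under eq_fun do rewrite scaler0.
have -> : (fun s y => f s.1 (a *: vcons s.2 y)) =
    fun (s : T * R) y => (fun p y => f p.1 (vcons p.2 (a *: y))) (s.1, a * s.2) y.
  by apply/funext => s; apply/funext => y; rewrite vconsZ.
apply: (@pmeas_pre _ _ _ _ _ (fun s : T * R => (s.1, a * s.2))
  (fun p y => f p.1 (vcons p.2 (a *: y)))); last exact: (IH _ _ (fun p y => f p.1 (vcons p.2 y))).
apply: measurable_fun_pair => //; exact: measurable_funM.
Qed.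

(** Joint measurability suffices: Tonelli applies to the positive and negative parts separately, and
    [fine] of their difference is measurable whatever values occur. *)
Lemma pmeas_gauss_exp n d (T : measurableType d) (f : T -> rV n -> R) :
  pmeas f -> measurable_fun [set: T] (fun s => gauss_exp (f s)).
Proof.
elim: n d T f => [|n IH] d T f //= mf.
have {IH mf} := IH _ _ _ mf => mG.
pose G (s : T) (t : R) := gauss_exp (fun y => f s (vcons t y)) * pdf t.
have mG2 : measurable_fun [set: T * R] (fun p => G p.1 p.2).
  apply: measurable_funM => //.
  by apply: (measurableT_comp (@measurable_gauss_pdf R)).
have mGs s : measurable_fun [set: R] (G s).
  apply: (measurableT_comp (g := fun t => (s, t)) mG2).
  exact: measurable_fun_pair.
have -> : (fun s => gauss1 (fun t => gauss_exp (fun y => f s (vcons t y)))) =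
    fun s => fine (\int[leb]_t (fun t => (G s t)%:E)^\+ t - \int[leb]_t (fun t => (G s t)%:E)^\- t)%E.
  apply/funext => s; rewrite -integralE /gauss1 /Rintegral.
  by rewrite completed_integralE //; apply/measurable_EFinP; exact: mGs.
apply: (measurableT_comp (f := fine)); first exact: fine_measurable.
apply: emeasurable_funB.
- rewrite (_ : (fun _ => _) = fubini_F leb (fun p : T * R => (G p.1 p.2)%:E)^\+%E).
    apply: measurable_fun_fubini_tonelli_F; last by move=> p; exact: funepos_ge0.
    by apply: measurable_funepos; apply/measurable_EFinP.
  by apply/funext => s; apply: eq_integral => t _; rewrite !funeposE.
- rewrite (_ : (fun _ => _) = fubini_F leb (fun p : T * R => (G p.1 p.2)%:E)^\-%E).
    apply: measurable_fun_fubini_tonelli_F; last by move=> p; exact: funeneg_ge0.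
    by apply: measurable_funeneg; apply/measurable_EFinP.
  by apply/funext => s; apply: eq_integral => t _; rewrite !funenegE.
Qed.

End NDim.

(** * Iterated Gaussian expectation: linearity, dilation, rotation of pairs *)

Section Tame.
Variable R : realType.
Local Notation rV n := 'rV[R]_n.

Definition borel n (f : rV n -> R) := pmeas (fun (_ : unit) x => f x).

Lemma borel_op (phi : R * R -> R) n (f g : rV n -> R) :
  measurable_fun setT phi -> borel f -> borel g -> borel (fun x => phi (f x, g x)).
Proof. by move=> mphi; exact: pmeas_op. Qed.

Lemma borelD n (f g : rV n -> R) : borel f -> borel g -> borel (fun x => f x + g x).
Proof. by apply: (@borel_op (fun p => p.1 + p.2)); exact: measurable_funD. Qed.

Lemma borelM n (f g : rV n -> R) : borel f -> borel g -> borel (fun x => f x * g x).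
Proof. by apply: (@borel_op (fun p => p.1 * p.2)); exact: measurable_funM. Qed.

Lemma borel_cst n c : borel (fun _ : rV n => c).
Proof. by apply: (@pmeas_par R n _ unit (fun=> c)); exact: measurable_cst. Qed.

Lemma borel_comp (phi : R -> R) n (f : rV n -> R) :
  measurable_fun setT phi -> borel f -> borel (fun x => phi (f x)).
Proof.
move=> mphi mf; apply: (@borel_op (fun p => phi p.1) _ f f) => //.
exact: measurableT_comp.
Qed.

Lemma borel_coord n i : borel (fun x : rV n => x 0 i).
Proof. exact: pmeas_coord. Qed.

Lemma borel_sum n (I : Type) (r : seq I) (P : pred I) (f : I -> rV n -> R) :
  (forall i, borel (f i)) -> borel (fun x => \sum_(i <- r | P i) f i x).
Proof.
move=> mf; elim: r => [|i r IH].
  by under eq_fun do rewrite big_nil; exact: borel_cst.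
under eq_fun do rewrite big_cons.
by case: (P i) => //; exact: borelD.
Qed.

Lemma borel_prod n (I : Type) (r : seq I) (P : pred I) (f : I -> rV n -> R) :
  (forall i, borel (f i)) -> borel (fun x => \prod_(i <- r | P i) f i x).
Proof.
move=> mf; elim: r => [|i r IH].
  by under eq_fun do rewrite big_nil; exact: borel_cst.
under eq_fun do rewrite big_cons.
by case: (P i) => //; exact: borelM.
Qed.

Lemma borel_lim n (F : nat -> rV n -> R) (f : rV n -> R) :
  (forall k, borel (F k)) -> (forall x, F k x @[k --> \oo] --> f x) -> borel f.
Proof. by move=> mF Ff; apply: (@pmeas_lim R n _ unit (fun k _ x => F k x)). Qed.

Lemma borel_scale n (f : rV n -> R) a : borel f -> borel (fun x => f (a *: x)).
Proof. exact: (@pmeas_scale R n _ unit (fun _ x => f x)). Qed.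

Lemma borel_vcons n (f : rV n.+1 -> R) t : borel f -> borel (fun y => f (vcons t y)).
Proof.
move=> mf.
apply: (@pmeas_pre R n _ _ (unit * R)%type unit (fun u => (u, t)) (fun s y => f (vcons s.2 y))) => //.
Qed.

Lemma measurable_gauss_exp_vcons n (f : rV n.+1 -> R) : borel f ->
  measurable_fun [set: R] (fun t => gauss_exp (fun y => f (vcons t y))).
Proof.
move=> mf.
have h := @pmeas_gauss_exp R n _ (unit * R)%type (fun s y => f (vcons s.2 y)) mf.
apply: (measurableT_comp (g := fun t : R => (tt, t)) h).
exact: measurable_fun_pair.
Qed.

Lemma borel_sqn n : borel (@sqn R n).
Proof.
apply: borel_sum => i; apply: (@borel_comp (fun t => t ^+ 2)); first exact: measurable_funX.
exact: borel_coord.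
Qed.

(** The weight factors over the coordinates, so fixing the first coordinate only changes the
    constant; this drives the inductions on the dimension. *)
Definition bounded_by n (f : rV n -> R) M := forall x, `|f x| <= M * expR (sqn x / 4).

Definition tame n (f : rV n -> R) := borel f /\ exists M, bounded_by f M.

Lemma bounded_by_vcons n (f : rV n.+1 -> R) M t : bounded_by f M ->
  bounded_by (fun y => f (vcons t y)) (M * expR (t ^+ 2 / 4)).
Proof.
by move=> fM y; apply: (le_trans (fM _)); rewrite sqn_vcons mulrDl expRD mulrA.
Qed.

Lemma tame_vcons n (f : rV n.+1 -> R) t : tame f -> tame (fun y => f (vcons t y)).
Proof.
move=> [mf [M fM]]; split; first exact: borel_vcons.
by exists (M * expR (t ^+ 2 / 4)); exact: bounded_by_vcons.
Qed.

Lemma tameD n (f g : rV n -> R) : tame f -> tame g -> tame (fun x => f x + g x).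
Proof.
move=> [mF [M FM]] [mG [N GN]]; split; first exact: borelD.
by exists (M + N) => t; rewrite mulrDl; apply: le_trans (ler_normD _ _) _; exact: lerD.
Qed.

Lemma tameMl n (f g : rV n -> R) M : borel f -> (forall x, `|f x| <= M) -> tame g ->
  tame (fun x => f x * g x).
Proof.
move=> mf fM [mg [N gN]]; split; first exact: borelM.
exists (M * N) => t; rewrite normrM -mulrA; apply: ler_pM => //; exact: fM.
Qed.

Lemma tame_bd n (f : rV n -> R) M : borel f -> (forall x, `|f x| <= M) -> tame f.
Proof.
move=> mf fM; split => //; exists M => x; apply: (le_trans (fM x)).
have M0 : 0 <= M by apply: le_trans (fM 0).
rewrite -[leLHS]mulr1 ler_wpM2l // -expR0 ler_expR.
by rewrite divr_ge0 // sqn_ge0.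
Qed.

Lemma tame_cst n c : tame (fun _ : rV n => c).
Proof. by apply: (@tame_bd _ _ `|c|) => //; exact: borel_cst. Qed.

Lemma tameZ n c (f : rV n -> R) : tame f -> tame (fun x => c * f x).
Proof. by apply: (@tameMl _ _ _ `|c|) => //; exact: borel_cst. Qed.

Lemma tame_sum n (I : Type) (r : seq I) (f : I -> rV n -> R) :
  (forall i, tame (f i)) -> tame (fun x => \sum_(i <- r) f i x).
Proof.
move=> gf; elim: r => [|i r IH].
  by under eq_fun do rewrite big_nil; exact: tame_cst.
by under eq_fun do rewrite big_cons; exact: tameD.
Qed.

(** Gaussian mean of the weight; each integrated coordinate multiplies the bound on an expectation
    by it. *)
Definition kappa : R := gauss1 (fun t => expR (t ^+ 2 / 4)).

Lemma tame1_weight c : tame1 (fun t : R => c * expR (t ^+ 2 / 4)).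
Proof.
split.
  apply: measurable_funM => //; apply: measurableT_comp => //.
  by apply: measurable_funM => //; exact: measurable_funX.
by exists `|c| => t; rewrite normrM [`|expR _|]ger0_norm // expR_ge0.
Qed.

Lemma gauss_exp_bound n (f : rV n -> R) M : borel f -> bounded_by f M ->
  `|gauss_exp f| <= M * kappa ^+ n.
Proof.
elim: n f M => [|n IH] f M mf fM.
  rewrite expr0 mulr1 /=; apply: (le_trans (fM 0)).
  by rewrite /sqn big_ord0 mul0r expR0 mulr1.
rewrite gauss_expS.
have hF t : `|gauss_exp (fun y => f (vcons t y))| <= M * kappa ^+ n * expR (t ^+ 2 / 4).
  rewrite mulrAC; apply: IH; first exact: borel_vcons.
  exact: bounded_by_vcons.
have gF : tame1 (fun t => gauss_exp (fun y => f (vcons t y))).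
  split; first exact: measurable_gauss_exp_vcons.
  by exists (M * kappa ^+ n).
rewrite exprSr mulrA {2}/kappa -gauss1Z; last first.
  by have := tame1_weight 1; under eq_fun do rewrite mul1r.
have gW := tame1_weight (M * kappa ^+ n).
rewrite ler_norml; apply/andP; split.
  rewrite -mulN1r -gauss1Z //; apply: gauss1_le => //; first exact: tame1Z.
  by move=> t; have := hF t; rewrite ler_norml mulN1r => /andP[].
by apply: gauss1_le => // t; have := hF t; rewrite ler_norml => /andP[].
Qed.

Lemma tame1_gauss_exp n (f : rV n.+1 -> R) : tame f ->
  tame1 (fun t => gauss_exp (fun y => f (vcons t y))).
Proof.
move=> [mf [M fM]]; split; first exact: measurable_gauss_exp_vcons.
exists (M * kappa ^+ n) => t; rewrite mulrAC; apply: gauss_exp_bound; first exact: borel_vcons.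
exact: bounded_by_vcons.
Qed.

Lemma gauss_expD n (f g : rV n -> R) : tame f -> tame g ->
  gauss_exp (fun x => f x + g x) = gauss_exp f + gauss_exp g.
Proof.
elim: n f g => [|n IH] f g gf gg //.
rewrite !gauss_expS -gauss1D; last 2 first.
- exact: tame1_gauss_exp.
- exact: tame1_gauss_exp.
congr gauss1; apply/funext => t.
exact: (IH _ _ (tame_vcons t gf) (tame_vcons t gg)).
Qed.

Lemma gauss_expZ n c (f : rV n -> R) : tame f ->
  gauss_exp (fun x => c * f x) = c * gauss_exp f.
Proof.
elim: n f => [|n IH] f gf //.
rewrite !gauss_expS -gauss1Z; last exact: tame1_gauss_exp.
congr gauss1; apply/funext => t.
exact: (IH _ (tame_vcons t gf)).
Qed.

Lemma gauss_exp_le n (f g : rV n -> R) : tame f -> tame g -> (forall x, f x <= g x) ->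
  gauss_exp f <= gauss_exp g.
Proof.
elim: n f g => [|n IH] f g gf gg fg; first exact: fg.
rewrite !gauss_expS; apply: gauss1_le; try exact: tame1_gauss_exp.
by move=> t; apply: IH => //; exact: tame_vcons.
Qed.

Lemma gauss_exp_cst n c : gauss_exp (fun _ : rV n => c) = c.
Proof.
elim: n => [|n IH] //; rewrite gauss_expS.
by under eq_fun do rewrite IH; exact: gauss1_cst.
Qed.

Lemma gauss_exp_sum n (I : Type) (r : seq I) (f : I -> rV n -> R) :
  (forall i, tame (f i)) ->
  gauss_exp (fun x => \sum_(i <- r) f i x) = \sum_(i <- r) gauss_exp (f i).
Proof.
move=> gf; elim: r => [|i r IH].
  by under eq_fun do rewrite big_nil; rewrite big_nil gauss_exp_cst.
under eq_fun do rewrite big_cons.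
by rewrite big_cons gauss_expD ?IH //; exact: tame_sum.
Qed.

Lemma gauss_exp_prod n c (h : 'I_n -> R -> R) : (forall i, tame1 (h i)) ->
  gauss_exp (fun x => c * \prod_i h i (x 0 i)) = c * \prod_i gauss1 (h i).
Proof.
elim: n c h => [|n IH] c h gh; first by rewrite /= !big_ord0.
rewrite gauss_expS big_ord_recl [_ * \prod_(i < n) _]mulrC mulrA -gauss1Z //.
congr gauss1; apply/funext => t.
rewrite mulrAC -(IH _ (fun j => h (lift ord0 j))) //.
congr gauss_exp; apply/funext => y.
rewrite big_ord_recl vcons0 mulrA; congr (_ * _).
by apply: eq_bigr => i _; rewrite vconsS.
Qed.

(** The substitution x -> l x, one coordinate at a time. The condition on l keeps the density ratio
    exp((1 - l^2) |x|^2 / 2) below the weight exp(|x|^2 / 4). *)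
Lemma gauss_exp_scale n l (f : rV n -> R) M : 0 < l -> 1 - l ^+ 2 <= 1 / 2 ->
  borel f -> (forall x, 0 <= f x <= M) ->
  gauss_exp (fun x => f (l^-1 *: x)) =
  l ^+ n * gauss_exp (fun x => f x * expR ((1 - l ^+ 2) / 2 * sqn x)).
Proof.
move=> l0 hl; elim: n f => [|n IH] f mf fM.
  rewrite /= scaler0 expr0 mul1r.
  by rewrite /sqn big_ord0 mulr0 expR0 mulr1.
pose w n (x : rV n) := expR ((1 - l ^+ 2) / 2 * sqn x).
have gfw (g : rV n -> R) : borel g -> (forall x, 0 <= g x <= M) -> tame (fun x => g x * w n x).
  move=> mg gM; apply: (@tameMl _ _ _ M) => //.
    by move=> x; rewrite ger0_norm; case/andP: (gM x).
  split.
    apply: (@borel_comp (fun t => expR ((1 - l ^+ 2) / 2 * t))); last exact: borel_sqn.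
    by apply: measurableT_comp => //; exact: measurable_funM.
  exists 1 => x; rewrite mul1r ger0_norm ?expR_ge0 // ler_expR.
  have : 0 <= (1 / 2 - (1 - l ^+ 2)) * sqn x by rewrite mulr_ge0 ?sqn_ge0 //; lra.
  lra.
rewrite !gauss_expS.
have mfw : borel (fun x => f x * w n.+1 x).
  apply: borelM => //.
  apply: (@borel_comp (fun t => expR ((1 - l ^+ 2) / 2 * t))); last exact: borel_sqn.
  by apply: measurableT_comp => //; exact: measurable_funM.
pose F u := gauss_exp (fun y => f (vcons u y) * w n y).
have FE t : gauss_exp (fun y => f (l^-1 *: vcons t y)) = l ^+ n * F (t / l).
  have -> : t / l = l^-1 * t by rewrite mulrC.
  under eq_fun do rewrite vconsZ.
  by apply: (IH (fun y => f (vcons _ y))) => //; exact: borel_vcons.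
have gF t : tame (fun y => f (vcons t y) * w n y).
  by apply: gfw => //; exact: borel_vcons.
have F2E t : gauss_exp (fun y => f (vcons t y) * w n.+1 (vcons t y)) =
    F t * expR ((1 - l ^+ 2) / 2 * t ^+ 2).
  rewrite [RHS]mulrC -gauss_expZ //; congr gauss_exp; apply/funext => y.
  by rewrite /w sqn_vcons mulrDr expRD; ring.
have F0 t : 0 <= F t.
  rewrite -(gauss_exp_cst n 0); apply: gauss_exp_le => //; first exact: tame_cst.
  by move=> y; rewrite mulr_ge0 ?expR_ge0 //; case/andP: (fM (vcons t y)).
have mF : measurable_fun [set: R] F.
  have h := measurable_gauss_exp_vcons mfw.
  have -> : F = fun t => gauss_exp (fun y => f (vcons t y) * w n.+1 (vcons t y)) * expR (- ((1 - l ^+ 2) / 2 * t ^+ 2)).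
    by apply/funext => t; rewrite F2E -mulrA -expRD subrr expR0 mulr1.
  apply: measurable_funM => //; apply: measurableT_comp => //.
  apply: measurableT_comp => //.
  by apply: measurable_funM; [exact: measurable_cst|exact: measurable_funX].
under eq_fun do rewrite FE.
(* By the induction hypothesis [F (t / l)] is l^{-n} times the mean of a function with values in
   [0, M], hence bounded. *)
have gFl : tame1 (fun t => F (t / l)).
  apply: (@tame1_bd _ _ (M * expR 0 * `|l ^- n|)).
    by apply: measurableT_comp => //; exact: measurable_funM.
  move=> t.
  have -> : F (t / l) = l ^- n * gauss_exp (fun y => f (l^-1 *: vcons t y)).
    by rewrite FE mulKf // expf_neq0 // gt_eqF.
  rewrite normrM mulrC ler_wpM2r // expR0 mulr1.
  have mg : borel (fun y => f (l^-1 *: vcons t y)).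
    exact: (@borel_vcons _ (fun x => f (l^-1 *: x)) t (borel_scale _ mf)).
  have bg y : `|f (l^-1 *: vcons t y)| <= M.
    by rewrite ger0_norm; case/andP: (fM (l^-1 *: vcons t y)).
  rewrite ger0_norm.
    rewrite -(gauss_exp_cst n M); apply: gauss_exp_le; [exact: tame_bd bg|exact: tame_cst|].
    by move=> y; case/andP: (fM (l^-1 *: vcons t y)).
  rewrite -(gauss_exp_cst n 0); apply: gauss_exp_le; [exact: tame_cst|exact: tame_bd bg|].
  by move=> y; case/andP: (fM (l^-1 *: vcons t y)).
rewrite (gauss1Z _ gFl) (gauss1_scale l0 mF F0) [l ^+ n.+1]exprSr -mulrA.
congr (_ * (_ * gauss1 _)).
by apply/funext => t; rewrite -F2E.
Qed.

(* Pairs of Gaussian vectors are encoded by interleaving their coordinates, so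
   that a 2n-fold iterated integral integrates both. *)
Fixpoint evens n : rV n.*2 -> rV n :=
  match n return rV n.*2 -> rV n with
  | 0 => fun _ => 0
  | m.+1 => fun z : rV m.*2.+2 => vcons (z 0 ord0) (evens (vtail (vtail z)))
  end.

Fixpoint odds n : rV n.*2 -> rV n :=
  match n return rV n.*2 -> rV n with
  | 0 => fun _ => 0
  | m.+1 => fun z : rV m.*2.+2 => vcons (vtail z 0 ord0) (odds (vtail (vtail z)))
  end.

Lemma evensS n (z : rV n.*2.+2) :
  evens (n := n.+1) z = vcons (z 0 ord0) (evens (vtail (vtail z))).
Proof. by []. Qed.

Lemma oddsS n (z : rV n.*2.+2) :
  odds (n := n.+1) z = vcons (vtail z 0 ord0) (odds (vtail (vtail z))).
Proof. by []. Qed.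

Lemma evens_vcons n s t (z : rV n.*2) :
  evens (n := n.+1) (vcons s (vcons t z)) = vcons s (evens z).
Proof. by rewrite /= vcons0 !vtail_vcons. Qed.

Lemma odds_vcons n s t (z : rV n.*2) :
  odds (n := n.+1) (vcons s (vcons t z)) = vcons t (odds z).
Proof. by rewrite /= !vtail_vcons vcons0. Qed.

Lemma sqn_evens_odds n (z : rV n.*2) : sqn z = sqn (evens z) + sqn (odds z).
Proof.
elim: n z => [|n IH] z; first by rewrite /sqn !big_ord0 addr0.
rewrite evensS oddsS -[LHS]/(@sqn R (n.*2).+2 z) -[z in LHS](@vcons_eta R n.*2.+1).
rewrite -[vtail z in LHS](@vcons_eta R n.*2) !sqn_vcons.
rewrite IH; ring.
Qed.

(** Each induction step combines one even and one odd coordinate, both already absorbed into the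
    parameter, so it is a measurable change of parameter. *)
Lemma pmeas_pair n d (T : measurableType d) (f : T -> rV n -> R) (a b : R) :
  pmeas f -> pmeas (fun s (z : rV n.*2) => f s (a *: evens z + b *: odds z)).
Proof.
elim: n d T f => [|n IH] d T f /= mf.
  by under eq_fun do rewrite !scaler0 addr0.
have -> : (fun s (y : rV n.*2) => f s.1.1 (a *: evens (n := n.+1) (vcons s.1.2 (vcons s.2 y))
      + b *: odds (n := n.+1) (vcons s.1.2 (vcons s.2 y)))) =
    fun (s : (T * R) * R) y => (fun p y => f p.1 (vcons p.2 (a *: evens y + b *: odds y)))
      (s.1.1, a * s.1.2 + b * s.2) y.
  apply/funext => s; apply/funext => y.
  by rewrite evens_vcons odds_vcons !vconsZ vconsD.
apply: (@pmeas_pre _ _ _ _ _ _ (fun s : (T * R) * R => (s.1.1, a * s.1.2 + b * s.2))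
  (fun p y => f p.1 (vcons p.2 (a *: evens y + b *: odds y)))); last first.
  exact: (IH _ _ (fun p y => f p.1 (vcons p.2 y))).
apply: measurable_fun_pair; first by apply: measurableT_comp => //.
apply: measurable_funD; apply: measurable_funM => //.
exact: measurableT_comp.
Qed.

Lemma borel_pair n (f : rV n -> R) (a b : R) : borel f ->
  borel (fun z : rV n.*2 => f (a *: evens z + b *: odds z)).
Proof. exact: (@pmeas_pair n _ unit (fun _ x => f x)). Qed.

(** Independence of the two interleaved vectors. *)
Lemma gauss_exp_pair_mul n (f g : rV n -> R) : tame f -> tame g ->
  gauss_exp (fun z : rV n.*2 => f (evens z) * g (odds z)) = gauss_exp f * gauss_exp g.
Proof.
elim: n f g => [|n IH] f g gf gg //.
rewrite [LHS](_ : _ = gauss1 (fun s => gauss1 (fun t => gauss_exp (fun y => f (vcons s y)) *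
    gauss_exp (fun y => g (vcons t y))))).
  rewrite !gauss_expS mulrC -gauss1Z; last exact: tame1_gauss_exp.
  congr gauss1; apply/funext => s.
  by rewrite gauss1Z 1?mulrC //; exact: tame1_gauss_exp.
rewrite [LHS]gauss_expS; congr gauss1; apply/funext => s.
rewrite [LHS]gauss_expS; congr gauss1; apply/funext => t.
under eq_fun do rewrite evens_vcons odds_vcons.
exact: (IH _ _ (tame_vcons s gf) (tame_vcons t gg)).
Qed.

(** Thanks to the interleaving, the two outer integrals form exactly the planar rotation of
    [gauss1_conv], and the inner ones are the induction hypothesis. *)
Lemma gauss_exp_conv n (f : rV n -> R) M (a b : R) : 0 < b -> a ^+ 2 + b ^+ 2 = 1 ->
  borel f -> (forall x, 0 <= f x <= M) ->
  gauss_exp (fun z : rV n.*2 => f (a *: evens z + b *: odds z)) = gauss_exp f.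
Proof.
move=> b0 ab; elim: n f => [|n IH] f mf fM.
  by rewrite /= !scaler0 addr0.
have bf y : `|f y| <= M by rewrite ger0_norm; case/andP: (fM y).
pose F t := gauss_exp (fun y => f (vcons t y)).
have mF : measurable_fun [set: R] F by exact: measurable_gauss_exp_vcons.
have FM t : 0 <= F t <= M.
  have gt : tame (fun y => f (vcons t y)) by apply: tame_vcons; exact: tame_bd bf.
  apply/andP; split.
    rewrite -[leLHS](gauss_exp_cst n); apply: gauss_exp_le => //; first exact: tame_cst.
    by move=> y; case/andP: (fM (vcons t y)).
  rewrite -[leRHS](gauss_exp_cst n); apply: gauss_exp_le => //; first exact: tame_cst.
  by move=> y; case/andP: (fM (vcons t y)).
apply: (etrans _ (gauss1_conv b0 ab mF FM)).
rewrite [LHS]gauss_expS; congr gauss1; apply/funext => s.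
rewrite [LHS]gauss_expS; congr gauss1; apply/funext => t.
under eq_fun do rewrite evens_vcons odds_vcons !vconsZ vconsD.
by apply: (IH (fun y => f (vcons _ y))) => //; exact: borel_vcons.
Qed.

End Tame.

(** * Convex sets and their closures *)

Section Convex.
Variable R : realType.
Local Notation rV n := 'rV[R]_n.
Local Notation leb := (@lebesgue_measure R).

Definition ind n (A : set (rV n)) (x : rV n) : R := (`[< A x >])%:R.

Lemma ind_bound n (A : set (rV n)) x : 0 <= ind A x <= 1.
Proof. by rewrite /ind; case: asbool; rewrite ?lexx ?ler01. Qed.

Lemma pm1E n (A : set (rV n)) x : pm1 A x = 2 * ind A x - 1.
Proof. by rewrite /pm1 /ind; case: asbool; rewrite /=; lra. Qed.

Definition cvx n (K : set (rV n)) := forall x y l, 0 <= l -> l <= 1 ->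
  K x -> K y -> K (l *: x + (1 - l) *: y).

Definition cl n (K : set (rV n)) : set (rV n) :=
  [set x | forall e, 0 < e -> exists2 y, K y & forall i, `|x 0 i - y 0 i| < e].

Lemma subset_cl n (K : set (rV n)) : K `<=` cl K.
Proof. by move=> x Kx e e0; exists x => // i; rewrite subrr normr0. Qed.

Lemma cvx_cl n (K : set (rV n)) : cvx K -> cvx (cl K).
Proof.
move=> cK x y l l0 l1 Kx Ky e e0.
have [x' Kx' xx'] := Kx _ e0; have [y' Ky' yy'] := Ky _ e0.
exists (l *: x' + (1 - l) *: y'); first exact: cK.
move=> i; rewrite !mxE.
have := xx' i; have := yy' i; rewrite !ltr_norml => /andP[h1 h2] /andP[h3 h4].
have [->|l0'] := eqVneq l 0; first by apply/andP; split; lra.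
have {}l0 : 0 < l by rewrite lt_def l0'.
apply/andP; split; nra.
Qed.

Definition slice n (K : set (rV n.+1)) t : set (rV n) := [set y | K (vcons t y)].

Lemma cvx_slice n (K : set (rV n.+1)) t : cvx K -> cvx (slice K t).
Proof.
move=> cK x y l l0 l1 Kx Ky; have := cK _ _ _ l0 l1 Kx Ky.
by rewrite !vconsZ vconsD -mulrDl addrC subrK mul1r.
Qed.

(** The sign condition puts t between t' and u, so the segment from (t', y') to (u, w) crosses
    height t inside K. For t' close to t the crossing is near y', hence near y. *)
Lemma slice_cl_half n (K : set (rV n.+1)) (s : R) t u w y e : cvx K -> K (vcons u w) ->
  t != u -> 0 < e -> cl K (vcons t y) ->
  exists2 d, 0 < d & forall t' y', K (vcons t' y') -> `|t - t'| < d ->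
    (forall i, `|y 0 i - y' 0 i| < d) -> 0 <= (t - t') * (u - t) ->
    exists2 y'', slice K t y'' & forall i, `|y 0 i - y'' 0 i| < e.
Proof.
move=> cK Kuw tu e0 cKt.
(* [B] bounds |y - w| in each coordinate and [g] is the height gap. The crossing parameter is at
   most d / g, so the crossing is within d (1 + B / g) <= e / 2 of y. *)
pose B := 1 + \sum_i `|y 0 i - w 0 i|.
have B0 : 1 <= B by rewrite lerDl; exact: sumr_ge0.
pose g := `|u - t|; have g0 : 0 < g by rewrite normr_gt0 subr_eq0 eq_sym.
exists (Num.min 1 (e / (2 * (1 + B / g)))).
  rewrite lt_min ltr01 divr_gt0 // mulr_gt0 // addr_gt0 // divr_gt0 //; lra.
move=> t' y' Kt' tt' yy' sgn.
set d := Num.min _ _ in tt' yy'.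
have d1 : d <= 1 by rewrite ge_min lexx.
have d0 : 0 <= d by exact: ltW (le_lt_trans _ tt').
have dB : d * (1 + B / g) <= e / 2.
  have : d <= e / (2 * (1 + B / g)) by rewrite ge_min lexx orbT.
  have p : 0 < 1 + B / g by rewrite addr_gt0 // divr_gt0 //; lra.
  by rewrite invfM mulrA ler_pdivlMr.
have ut' : `|u - t'| = g + `|t - t'|.
  rewrite /g; case: (ltgtP t u) tu sgn => // tlu _ sgn.
  - have t't : 0 <= t - t' by move: sgn; rewrite pmulr_lge0 // subr_gt0.
    by rewrite !ger0_norm //; lra.
  - have t't : t - t' <= 0 by move: sgn; rewrite nmulr_lge0 // subr_lt0.
    by rewrite !ler0_norm //; lra.
pose m := (t - t') / (u - t').
have ut0 : u - t' != 0.
  by rewrite -normr_eq0 ut' gt_eqF // ltr_pwDl.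
have m0 : 0 <= m.
  rewrite /m; case: (ltgtP t u) tu sgn => // tlu _ sgn.
  - have t't : 0 <= t - t' by move: sgn; rewrite pmulr_lge0 // subr_gt0.
    by apply: divr_ge0; lra.
  - have t't : t - t' <= 0 by move: sgn; rewrite nmulr_lge0 // subr_lt0.
    by rewrite -divrNN; apply: divr_ge0; lra.
have mE : m = `|t - t'| / (g + `|t - t'|) by rewrite -ut' -normf_div ger0_norm.
have m1 : m <= 1 by rewrite mE ler_pdivrMr ?mul1r ?lerDr ?ltW // ltr_pwDl.
have md : m <= d / g.
  rewrite mE; apply: (@le_trans _ _ (`|t - t'| / g)).
    by rewrite ler_wpM2l // lef_pV2 ?posrE ?lerDl // ltr_pwDl.
  by rewrite ler_wpM2r ?invr_ge0 ?ltW.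
exists (m *: w + (1 - m) *: y').
  rewrite /slice /=.
  have -> : t = m * u + (1 - m) * t'.
    have -> : m * u + (1 - m) * t' = m * (u - t') + t' by ring.
    by rewrite /m divfK // subrK.
  by rewrite -vconsD -!vconsZ; exact: cK.
move=> i; rewrite !mxE.
have -> : y 0 i - (m * w 0 i + (1 - m) * y' 0 i) =
  m * (y 0 i - w 0 i) + (1 - m) * (y 0 i - y' 0 i) by ring.
have hB : `|y 0 i - w 0 i| <= B.
  rewrite /B (bigD1 i) //= addrCA lerDl addr_ge0 //; exact: sumr_ge0.
apply: (@le_lt_trans _ _ (d / g * B + d)).
  apply: le_trans (ler_normD _ _) _; rewrite (normrM m) (normrM (1 - m)) (ger0_norm m0).
  rewrite (_ : `|1 - m| = 1 - m); last by rewrite ger0_norm // subr_ge0.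
  apply: lerD; first by apply: ler_pM.
  rewrite -[leRHS]mul1r; apply: ler_pM => //; rewrite ?subr_ge0 ?gerBl //.
  exact/ltW/yy'.
have -> : d / g * B + d = d * (1 + B / g) by ring.
lra.
Qed.

(** An approximating point of K below height t is joined to the given point above it, and
    conversely. *)
Lemma slice_cl n (K : set (rV n.+1)) t u1 u2 w1 w2 : cvx K ->
  K (vcons u1 w1) -> K (vcons u2 w2) -> u1 < t -> t < u2 ->
  slice (cl K) t `<=` cl (slice K t).
Proof.
move=> cK K1 K2 u1t tu2 y Ky e e0.
have [d1 d10 h1] := slice_cl_half 0 cK K1 (negbT (gt_eqF u1t)) e0 Ky.
have [d2 d20 h2] := slice_cl_half 0 cK K2 (negbT (lt_eqF tu2)) e0 Ky.
have d0 : 0 < Num.min d1 d2 by rewrite lt_min d10.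
have [x Kx xy] := Ky _ d0; rewrite -(vcons_eta x) in Kx.
have xt := xy ord0; rewrite vcons0 in xt.
have xs i := xy (lift ord0 i).
have xs' i : `|y 0 i - vtail x 0 i| < Num.min d1 d2 by have := xs i; rewrite vconsS mxE.
have [le|lt] := leP (x 0 ord0) t.
- apply: (h2 _ _ Kx).
  + by move: xt; rewrite lt_min => /andP[].
  + by move=> i; have := xs' i; rewrite lt_min => /andP[].
  + by rewrite mulr_ge0 ?subr_ge0 // ltW.
- apply: (h1 _ _ Kx).
  + by move: xt; rewrite lt_min => /andP[].
  + by move=> i; have := xs' i; rewrite lt_min => /andP[].
  + by rewrite mulr_le0 ?subr_le0 // ltW.
Qed.

(* Negligible for iterated integrals; no measurability is required. *)
Fixpoint slim n : set (rV n) -> Prop :=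
  match n return set (rV n) -> Prop with
  | 0 => fun N => N = set0
  | m.+1 => fun N => exists s : seq R, forall t, t \notin s -> slim (slice N t)
  end.

Lemma slimS n (A B : set (rV n)) : A `<=` B -> slim B -> slim A.
Proof.
elim: n A B => [|n IH] A B AB /=; first by move=> B0; rewrite B0 subset0 in AB.
move=> [s sB]; exists s => t ts; apply: (IH _ (slice B t)); last exact: sB.
by move=> y; exact: AB.
Qed.

Lemma slim0 n : slim (set0 : set (rV n)).
Proof. by elim: n => [|n IH] //=; exists [::] => t _. Qed.

(* Closure and slicing commute except at the two ends of the projection of K. *)
Lemma slim_clD n (K : set (rV n)) : cvx K -> slim (cl K `\` K).
Proof.
elim: n K => [|n IH] K cK.
  apply/seteqP; split => // x [cKx nKx]; apply: nKx.
  have [y Ky _] := cKx 1 ltr01.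
  by rewrite (_ : x = y) //; apply/rowP; case.
pose I := [set t : R | exists y, K (vcons t y)].
exists [:: sup I; inf I] => t; rewrite !inE negb_or => /andP[ts ti].
(* If no point of K lies above t, then t is an upper bound of [I] other than [sup I], so the slice
   of the closure at t is empty; the other end is symmetric. If [I] has no finite bound the listed
   values are defaults, and excluding them does no harm. *)
have [[u2 [w2 K2] tu2]|n2] := pselect (exists2 u, I u & t < u); last first.
  have ubI : ubound I t by move=> u Iu; rewrite leNgt; apply/negP => tu; apply: n2; exists u.
  apply: (slimS _ (slim0 n)) => y [cKy _].
  have [x0 Kx0 _] := cKy 1 ltr01; rewrite -(vcons_eta x0) in Kx0.
  have neI : I !=set0 by exists (x0 0 ord0); exists (vtail x0).
  have st : sup I < t by rewrite lt_def eq_sym eq_sym ts ge_sup.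
  have : 0 < t - sup I by rewrite subr_gt0.
  move=> /cKy[x Kx /(_ ord0)]; rewrite vcons0 -(vcons_eta x) in Kx *; rewrite vcons0.
  have : x 0 ord0 <= sup I by apply: ub_le_sup; [exists t|exists (vtail x)].
  by rewrite ltr_norml => h /andP[_ h2]; lra.
have [[u1 [w1 K1] tu1]|n1] := pselect (exists2 u, I u & u < t); last first.
  have lbI : lbound I t by move=> u Iu; rewrite leNgt; apply/negP => tu; apply: n1; exists u.
  apply: (slimS _ (slim0 n)) => y [cKy _].
  have [x0 Kx0 _] := cKy 1 ltr01; rewrite -(vcons_eta x0) in Kx0.
  have neI : I !=set0 by exists (x0 0 ord0); exists (vtail x0).
  have st : t < inf I by rewrite lt_def eq_sym ti lb_le_inf.
  have : 0 < inf I - t by rewrite subr_gt0.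
  move=> /cKy[x Kx /(_ ord0)]; rewrite vcons0 -(vcons_eta x) in Kx *; rewrite vcons0.
  have : inf I <= x 0 ord0 by apply: ge_inf; [exists t|exists (vtail x)].
  by rewrite ltr_norml => h /andP[h2 _]; lra.
have := IH (slice K t) (@cvx_slice _ K t cK); apply: slimS => y [cKy nKy]; split => //.
exact: (slice_cl cK K1 K2 tu1 tu2).
Qed.

(** [F] may take arbitrary values on [s], as inner integrals over non-measurable slices do. Its
    measurability is derived by correcting one point at a time towards [G]. *)
Lemma gauss1_eq_off (s : seq R) (F G : R -> R) : measurable_fun [set: R] G ->
  (forall t, t \notin s -> F t = G t) -> gauss1 F = gauss1 G.
Proof.
move=> mG; suff : (forall t, t \notin s -> F t = G t) ->
  measurable_fun [set: R] F /\ gauss1 F = gauss1 G by move=> h /h[].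
elim: s F => [|a s IH] F FG.
  by have -> : F = G by apply/funext => t; exact: FG.
pose F' t := if t == a then G a else F t.
have [t ts|mF' F'G] := IH F'.
  rewrite /F'; case: eqVneq => [->//|ta]; apply: FG.
  by rewrite inE negb_or ta.
have mF : measurable_fun [set: R] F.
  have -> : F = fun t => if t == a then F a else F' t.
    by apply/funext => t; rewrite /F'; case: eqVneq => // ->.
  apply: measurable_fun_ifT => //; exact: measurable_fun_eqr.
split => //; rewrite -F'G !gauss1E //; congr fine.
have mp (H : R -> R) : measurable_fun [set: R] H ->
    measurable_fun [set: R] (fun t => (H t * gauss_pdf t)%:E).
  move=> mH; apply/measurable_EFinP/measurable_funM => //; exact: measurable_gauss_pdf.
apply: ae_eq_integral => //; try exact: mp.
exists [set a]; split => //; first exact: lebesgue_measure_set1.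
move=> t /= h; apply: contrapT => /eqP ta; apply: h => _.
by rewrite /F' (negbTE ta).
Qed.

Lemma gauss_exp_slim n (N : set (rV n)) f g : slim N -> borel g ->
  (forall x, ~ N x -> f x = g x) -> gauss_exp f = gauss_exp g.
Proof.
elim: n N f g => [|n IH] N f g /=.
  by move=> -> _ ->.
move=> [s sN] mg fg; apply: (gauss1_eq_off (s := s)).
  exact: measurable_gauss_exp_vcons.
move=> t ts; apply: (IH (slice N t)); [exact: sN|exact: borel_vcons|].
by move=> y; exact: fg.
Qed.

End Convex.

(** * Hermite coefficients *)

Section Coef.
Variable R : realType.
Local Notation rV n := 'rV[R]_n.

(** The complement of the closure is the union of countably many open cubes with rational centre and
    half-width 1 / (k + 1) whose doubles miss K. The indicator of the closure is the limit of the
    finite products of 1 minus the indicators of these cubes. *)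
Lemma borel_ind_cl n (K : set (rV n)) : borel (ind (cl K)).
Proof.
pose dl (k : nat) : R := k.+1%:R^-1.
have dl0 k : 0 < dl k by rewrite invr_gt0.
pose clear (q : {ffun 'I_n -> rat}) k :=
  forall y, K y -> ~ forall i, `|y 0 i - ratr (q i)| < 2 * dl k.
pose B (j : nat) (x : rV n) : R := match unpickle j : option ({ffun 'I_n -> rat} * nat) with
  | Some (q, k) => if `[< clear q k >] then
      \prod_(i < n) (if `|x 0 i - ratr (q i)| < dl k then 1 else 0) else 0
  | None => 0 end.
have mB j : borel (B j).
  rewrite /B; case: unpickle => [[q k]|]; last exact: borel_cst.
  case: asbool; last exact: borel_cst.
  apply: borel_prod => i.
  apply: (@borel_comp _ (fun t => if `|t - ratr (q i)| < dl k then 1 else 0)); last exact: borel_coord.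
  apply: measurable_fun_ifT => //; apply: measurable_fun_ltr => //.
  apply: measurableT_comp => //.
  exact: measurable_funB.
apply: (@borel_lim _ _ (fun m x => \prod_(j < m) (1 - B j x))).
  move=> m; apply: borel_prod => j; apply: (@borel_comp _ (fun t => 1 - t)) => //.
  exact: measurable_funB.
move=> x; rewrite /ind; case: asboolP => [Kx|nKx].
  rewrite (_ : (fun _ => _) = fun=> 1); first exact: cvg_cst.
  apply/funext => m; apply: big1 => j _.
  rewrite /B; case: unpickle => [[q k]|]; last by rewrite subr0.
  case: asboolP => [h|_]; last by rewrite subr0.
  have [y Ky xy] := Kx _ (dl0 k).
  have [i hi] : exists i, ~ `|y 0 i - ratr (q i)| < 2 * dl k.
    by apply/existsNP; exact: h.
  rewrite (bigD1 i) //= ifF ?mul0r ?subr0 //.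
  apply/negP => xq; apply: hi; rewrite [2 * _]mulr_natl mulr2n.
  apply: le_lt_trans (ler_distD (x 0 i) _ _) _; rewrite ltrD //.
  by rewrite distrC.
have [e e0 he] : exists2 e, 0 < e & forall y, K y -> ~ forall i, `|x 0 i - y 0 i| < e.
  apply: contrapT => h; apply: nKx => e e0; apply: contrapT => h'; apply: h.
  by exists e => // y Ky xy; apply: h'; exists y.
(* The cube must have x within [dl k] of its centre and its double inside the e-cube around x: 1 + 2
   = 3. *)
have [k hk] : exists k, 3 * dl k < e.
  have e3 : 0 < e / 3 by rewrite divr_gt0.
  have [k _ h] := near_infty_natSinv_lt (PosNum e3).
  have hk : dl k < e / 3 by exact: (h k (leqnn k)).
  exists k; move: hk; set d := dl k; lra.
have [q hq] : exists q : 'I_n -> rat, forall i, `|x 0 i - ratr (q i)| < dl k.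
  suff : forall i, exists q : rat, `|x 0 i - ratr q| < dl k.
    by move=> /(@fin_all_exists 'I_n (fun=> rat))[q hq]; exists q.
  move=> i.
  have [|q] := @rat_in_itvoo R (x 0 i - dl k) (x 0 i + dl k).
    by have := dl0 k; lra.
  by rewrite in_itv /= => hq; exists q; rewrite ltr_norml; lra.
apply: cvg_near_cst; near=> m.
have hm : (pickle ([ffun i => q i], k) < m)%N.
  by near: m; exists (pickle ([ffun i => q i], k)).+1.
rewrite (bigD1 (Ordinal hm)) //= /B pickleK ifT.
  rewrite big1 ?subrr ?mul0r // => i _.
  by rewrite ffunE hq.
apply/asboolP => y Ky hy; apply: (he y Ky) => i.
have := hy i; rewrite ffunE => h1; have h2 := hq i.
apply: lt_trans hk; apply: le_lt_trans (ler_distD (ratr (q i)) _ _) _.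
rewrite [ltLHS]addrC [`|ratr _ - _|]distrC; lra.
Unshelve. all: by end_near.
Qed.

Lemma measurable_hermite k : measurable_fun [set: R] (hermite (R := R) k).
Proof.
suff h : measurable_fun [set: R] (hermiteHe (R := R) k) by exact: measurable_funM.
have [m] := ubnP k; elim: m k => // m IH [|[|k]] hk.
- exact: measurable_cst.
- exact: measurable_id.
have -> : hermiteHe k.+2 = fun x : R => x * hermiteHe k.+1 x - k.+1%:R * hermiteHe k x by [].
have h1 : measurable_fun [set: R] (hermiteHe (R := R) k.+1) by apply: IH.
have h2 : measurable_fun [set: R] (hermiteHe (R := R) k) by apply: IH; exact: ltnW.
by apply: measurable_funB; apply: measurable_funM.
Qed.

Lemma borel_hermiteS n (S : 'I_n -> nat) : borel (hermiteS (R := R) S).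
Proof.
apply: borel_prod => i; apply: borel_comp; first exact: measurable_hermite.
exact: borel_coord.
Qed.

Lemma hcoef_cl n (K : set (rV n)) S : cvx K -> hcoef (pm1 K) S = hcoef (pm1 (cl K)) S.
Proof.
move=> cK; apply: (gauss_exp_slim (slim_clD cK)).
  apply: borelM; last exact: borel_hermiteS.
  have -> : pm1 (cl K) = fun x => 2 * ind (cl K) x - 1 by apply/funext => x; exact: pm1E.
  apply: (@borel_comp _ (fun t => 2 * t - 1)); last exact: borel_ind_cl.
  by apply: measurable_funB => //; exact: measurable_funM.
move=> x nx; congr (_ * _); rewrite /pm1.
case: (asboolP (K x)) => Kx; case: asboolP => // cKx.
- by case: cKx; exact: subset_cl.
- by case: nx.
Qed.

Lemma hermite0 (x : R) : hermite 0 x = 1.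
Proof. by rewrite /hermite /= sqrtr1 divr1. Qed.

Lemma hermite1 (x : R) : hermite 1 x = x.
Proof. by rewrite /hermite /= sqrtr1 divr1. Qed.

Lemma hermite2 (x : R) : hermite 2 x = (x ^+ 2 - 1) / Num.sqrt 2.
Proof. by rewrite /hermite /= mulr1 expr2. Qed.

Lemma tame1_hermite k : (k <= 2)%N -> tame1 (hermite (R := R) k).
Proof.
case: k => [|[|[|//]]] _.
- rewrite (_ : hermite 0 = fun=> 1); last by apply/funext => x; rewrite hermite0.
  exact: tame1_cst.
- rewrite (_ : hermite 1 = id); last by apply/funext => x; rewrite hermite1.
  exact: tame1_id.
have -> : hermite 2 = fun x : R => - (Num.sqrt 2)^-1 + 0 * x + (Num.sqrt 2)^-1 * x ^+ 2.
  by apply/funext => x; rewrite hermite2; ring.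
exact: tame1_quadratic.
Qed.

Lemma gauss1_hermite k : (0 < k <= 2)%N -> gauss1 (hermite (R := R) k) = 0.
Proof.
case: k => [|[|[|//]]] //= _.
- rewrite (_ : hermite 1 = id); last by apply/funext => x; rewrite hermite1.
  exact: gauss1_id.
have -> : hermite 2 = fun x : R => (Num.sqrt 2)^-1 * (x ^+ 2 + (-1)).
  by apply/funext => x; rewrite hermite2; ring.
rewrite gauss1Z; last by apply: tame1D; [exact: tame1_sqr|exact: tame1_cst].
rewrite gauss1D; [|exact: tame1_sqr|exact: tame1_cst].
by rewrite gauss1_sqr gauss1_cst subrr mulr0.
Qed.

Lemma gauss_exp_prod1 n (h : 'I_n -> R -> R) : (forall i, tame1 (h i)) ->
  gauss_exp (fun x => \prod_i h i (x 0 i)) = \prod_i gauss1 (h i).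
Proof.
move=> gh; rewrite -[RHS]mul1r -gauss_exp_prod //.
by congr gauss_exp; apply/funext => x; rewrite mul1r.
Qed.

Lemma gauss_exp_hermiteS n (S : 'I_n -> nat) i : (forall k, (S k <= 2)%N) -> (0 < S i)%N ->
  gauss_exp (hermiteS (R := R) S) = 0.
Proof.
move=> S2 Si.
rewrite [LHS](@gauss_exp_prod1 n (fun k => hermite (S k)) (fun k => tame1_hermite (S2 k))).
by rewrite (bigD1 i) //= gauss1_hermite ?mul0r // Si S2.
Qed.

Lemma tame_le_sqn n (f : rV n -> R) a b : 0 <= a -> 0 <= b -> borel f ->
  (forall x, `|f x| <= a + b * sqn x) -> tame f.
Proof.
move=> a0 b0 mf fab; split => //; exists (a + 4 * b) => x; apply: (le_trans (fab x)).
have s0 := sqn_ge0 x; have := expR_ge1Dx (sqn x / 4) => h.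
apply: (@le_trans _ _ ((a + 4 * b) * (1 + sqn x / 4))); last first.
  by rewrite ler_wpM2l // addr_ge0 // mulr_ge0.
have : 0 <= a * sqn x by rewrite mulr_ge0.
lra.
Qed.

Lemma sqr_le_sqn n (x : rV n) i : x 0 i ^+ 2 <= sqn x.
Proof.
by rewrite /sqn (bigD1 i) //= lerDl; apply: sumr_ge0 => j _; exact: sqr_ge0.
Qed.

Lemma tame_coord n i : tame (fun x : rV n => x 0 i).
Proof.
apply: (@tame_le_sqn _ _ 1 1) => //; first exact: borel_coord.
move=> x; have := sqr_le_sqn x i; rewrite -(real_normK (num_real (x 0 i))).
have := normr_ge0 (x 0 i); nra.
Qed.

Lemma tame_coordM n i j : tame (fun x : rV n => x 0 i * x 0 j).
Proof.
apply: (@tame_le_sqn _ _ 0 1) => //; first by apply: borelM; exact: borel_coord.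
move=> x; rewrite normrM add0r mul1r.
have := sqr_le_sqn x i; rewrite -(real_normK (num_real (x 0 i))).
have := sqr_le_sqn x j; rewrite -(real_normK (num_real (x 0 j))).
have := sqr_ge0 (`|x 0 i| - `|x 0 j|); nra.
Qed.

Lemma tame_sqn n : tame (@sqn R n).
Proof.
apply: (@tame_le_sqn _ _ 0 1) => //; first exact: borel_sqn.
by move=> x; rewrite ger0_norm ?sqn_ge0 // add0r mul1r.
Qed.

Lemma tame_ind n (K : set (rV n)) f : tame f -> tame (fun x => ind (cl K) x * f x).
Proof.
apply: (@tameMl _ _ _ _ 1); first exact: borel_ind_cl.
by move=> x; have := ind_bound (cl K) x => /andP[? ?]; rewrite ger0_norm.
Qed.

(** Multi-indices e_j and e_j + e_l are written as sums of the booleans [k == j], so that diagonal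
    and off-diagonal coefficients of degree 2 share one form. *)
Lemma hermiteS_1 n j (x : rV n) : hermiteS (fun k => (k == j) : nat) x = x 0 j.
Proof.
rewrite /hermiteS (bigD1 j) //= eqxx hermite1 big1 ?mulr1 // => k kj.
by rewrite (negbTE kj) hermite0.
Qed.

Lemma hermiteS_11 n j l (x : rV n) : j != l ->
  hermiteS (fun k => (k == j) + (k == l))%N x = x 0 j * x 0 l.
Proof.
move=> jl; rewrite /hermiteS (bigD1 j) //= eqxx (negbTE jl) hermite1.
rewrite (bigD1 l) /= ?[l == j]eq_sym ?(negbTE jl) // eqxx hermite1 big1 ?mulr1 // => k /andP[kj kl].
by rewrite (negbTE kj) (negbTE kl) hermite0.
Qed.

Lemma hermiteS_2 n j (x : rV n) :
  hermiteS (fun k => (k == j) + (k == j))%N x = (x 0 j ^+ 2 - 1) / Num.sqrt 2.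
Proof.
rewrite /hermiteS (bigD1 j) //= eqxx hermite2 big1 ?mulr1 // => k kj.
by rewrite (negbTE kj) hermite0.
Qed.

(** The constant -1 in 2 * 1_K - 1 is orthogonal to every Hermite polynomial with a positive
    index. *)
Lemma hcoef_ind n (K : set (rV n)) (S : 'I_n -> nat) i : (forall k, (S k <= 2)%N) ->
  (0 < S i)%N -> tame (hermiteS (R := R) S) ->
  hcoef (pm1 (cl K)) S = 2 * gauss_exp (fun x => ind (cl K) x * hermiteS S x).
Proof.
move=> S2 Si gS; rewrite /hcoef.
under eq_fun do rewrite pm1E mulrDl mulN1r -mulrA -mulN1r.
rewrite gauss_expD; last 2 first.
- exact/tameZ/tame_ind.
- exact: tameZ.
rewrite !gauss_expZ //; last exact: tame_ind.
by rewrite (gauss_exp_hermiteS S2 Si) mulr0 addr0.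
Qed.

Lemma hcoef_0 n (K : set (rV n)) (S : 'I_n -> nat) : (forall k, S k = 0%N) ->
  hcoef (pm1 (cl K)) S = 2 * gauss_exp (ind (cl K)) - 1.
Proof.
move=> S0; rewrite /hcoef.
have gi : tame (ind (cl K)).
  have := tame_ind K (tame_cst n 1).
  by rewrite (_ : (fun x => _) = ind (cl K)) //; apply/funext => x; rewrite mulr1.
have -> : (fun x => pm1 (cl K) x * hermiteS S x) = fun x => 2 * ind (cl K) x + (-1).
  apply/funext => x; rewrite pm1E /hermiteS big1 ?mulr1 // => k _.
  by rewrite S0 hermite0.
by rewrite gauss_expD ?gauss_expZ ?gauss_exp_cst //; [exact: tameZ|exact: tame_cst].
Qed.

Lemma hcoef_1 n (K : set (rV n)) (j : 'I_n) :
  hcoef (pm1 (cl K)) (fun k => (k == j) : nat) = 2 * gauss_exp (fun x => ind (cl K) x * x 0 j).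
Proof.
rewrite (@hcoef_ind _ _ _ j) ?eqxx //.
- by congr (_ * gauss_exp _); apply/funext => x; rewrite hermiteS_1.
- by move=> k; case: eqP.
- rewrite (_ : hermiteS _ = fun x => x 0 j); first exact: tame_coord.
  by apply/funext => x; rewrite hermiteS_1.
Qed.

Lemma hcoef_11 n (K : set (rV n)) j l : j != l ->
  hcoef (pm1 (cl K)) (fun k => (k == j) + (k == l))%N =
  2 * gauss_exp (fun x => ind (cl K) x * (x 0 j * x 0 l)).
Proof.
move=> jl; rewrite (@hcoef_ind _ _ _ j) ?eqxx //.
- by congr (_ * gauss_exp _); apply/funext => x; rewrite hermiteS_11.
- by move=> k; case: eqP; case: eqP.
- rewrite (_ : hermiteS _ = fun x => x 0 j * x 0 l); first exact: tame_coordM.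
  by apply/funext => x; rewrite hermiteS_11.
Qed.

Lemma hcoef_2 n (K : set (rV n)) (j : 'I_n) :
  hcoef (pm1 (cl K)) (fun k => (k == j) + (k == j))%N =
  Num.sqrt 2 * (gauss_exp (fun x => ind (cl K) x * (x 0 j * x 0 j)) - gauss_exp (ind (cl K))).
Proof.
have gi : tame (ind (cl K)).
  have := tame_ind K (tame_cst n 1).
  by rewrite (_ : (fun x => _) = ind (cl K)) //; apply/funext => x; rewrite mulr1.
have s2 : Num.sqrt 2 * Num.sqrt 2 = 2 :> R by rewrite -expr2 sqr_sqrtr.
have s0 : Num.sqrt 2 != 0 :> R by rewrite sqrtr_eq0 -ltNge.
have gx : tame (fun x : rV n => x 0 j * x 0 j + -1).
  by apply: tameD; [exact: tame_coordM|exact: tame_cst].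
have E (x : rV n) : hermiteS (fun k => (k == j) + (k == j))%N x = (Num.sqrt 2)^-1 * (x 0 j * x 0 j + -1).
  by rewrite hermiteS_2 expr2 mulrC.
rewrite (@hcoef_ind _ _ _ j) ?eqxx //.
- under eq_fun do rewrite E mulrCA mulrDr mulrN1 -mulN1r.
  rewrite gauss_expZ; last first.
    by apply: tameD; [exact: tame_ind (tame_coordM _ _)|exact: tameZ].
  rewrite gauss_expD; [|exact: tame_ind (tame_coordM _ _)|exact: tameZ].
  rewrite gauss_expZ // mulN1r mulrA; congr (_ * _).
  by rewrite -[X in X / _]s2 mulfK.
- by move=> k; case: eqP.
- rewrite (_ : hermiteS _ = fun x => (Num.sqrt 2)^-1 * (x 0 j * x 0 j + -1)); first exact: tameZ.
  by apply/funext => x; rewrite E.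
Qed.

Lemma hcoef_le_Weq1 n (f : rV n -> R) (j : 'I_n) : hcoef f (fun k => (k == j) : nat) ^+ 2 <= Weq f 1.
Proof.
pose S : {ffun 'I_n -> 'I_2} := [ffun k => inord (k == j)].
have SE k : S k = (k == j) :> nat by rewrite ffunE inordK // ltnS; case: eqP.
rewrite /Weq (bigD1 S) /=; last first.
  rewrite (eq_bigr (fun k => (k == j) : nat)) // (bigD1 j) //= eqxx big1 // => k kj.
  by rewrite (negbTE kj).
rewrite -[leLHS]addr0; apply: lerD; last by apply: sumr_ge0 => *; exact: sqr_ge0.
by rewrite (_ : (fun k => S k : nat) = fun k => (k == j) : nat) //; apply/funext.
Qed.

(** The indices 2 e_j are distinct, so their n squares occur together in the sum; the final
    Cauchy-Schwarz needs them all at once. *)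
Lemma sum_hcoef_le_Weq2 n (f : rV n -> R) :
  \sum_j hcoef f (fun k => (k == j) + (k == j))%N ^+ 2 <= Weq f 2.
Proof.
pose S j : {ffun 'I_n -> 'I_3} := [ffun k => inord ((k == j) + (k == j))].
have SE j k : S j k = ((k == j) + (k == j))%N :> nat.
  by rewrite ffunE inordK // ltnS; case: eqP.
have injS : injective S.
  move=> i j /ffunP/(_ i)/(congr1 val) /=; rewrite !SE eqxx.
  by case: eqP.
rewrite /Weq (bigID (mem (S @: 'I_n))) /= -[leLHS]addr0; apply: lerD; last first.
  by apply: sumr_ge0 => *; exact: sqr_ge0.
rewrite (eq_bigl (mem (S @: 'I_n))); last first.
  move=> s /=; rewrite andb_idl // => /imsetP[j _ ->].
  rewrite (eq_bigr (fun k => (k == j) + (k == j))%N) // (bigD1 j) //= eqxx big1 // => k kj.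
  by rewrite (negbTE kj).
rewrite big_imset /=; last by move=> i j _ _; exact: injS.
rewrite le_eqVlt; apply/orP; left; apply/eqP; apply: eq_big => // j _.
by congr (hcoef _ _ ^+ 2); apply/funext => k; rewrite SE.
Qed.

Lemma hcoef_le_Weq2 n (f : rV n -> R) j l :
  hcoef f (fun k => (k == j) + (k == l))%N ^+ 2 <= Weq f 2.
Proof.
pose S : {ffun 'I_n -> 'I_3} := [ffun k => inord ((k == j) + (k == l))].
have SE k : S k = ((k == j) + (k == l))%N :> nat.
  by rewrite ffunE inordK // ltnS; case: eqP; case: eqP.
rewrite /Weq (bigD1 S) /=; last first.
  rewrite (eq_bigr (fun k => (k == j) + (k == l))%N) // big_split /=.
  have h i : (\sum_(k < n) (k == i) = 1)%N.
    by rewrite (bigD1 i) //= eqxx big1 // => k ki; rewrite (negbTE ki).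
  by rewrite !h.
rewrite -[leLHS]addr0; apply: lerD; last by apply: sumr_ge0 => *; exact: sqr_ge0.
by rewrite (_ : (fun k => S k : nat) = fun k => (k == j) + (k == l))%N //; apply/funext.
Qed.

Lemma Weq0E n (f : rV n -> R) : Weq f 0 = hcoef f (fun=> 0%N) ^+ 2.
Proof.
have h0 (S : {ffun 'I_n -> 'I_1}) : (fun i => S i : nat) = fun=> 0%N.
  by apply/funext => i; case: (S i) => -[].
rewrite /Weq (bigD1 [ffun=> ord0]) /=; last first.
  by rewrite big1 // => i _; rewrite ffunE.
rewrite h0 big1 ?addr0 // => S /andP[_ /negP h]; exfalso; apply: h.
by apply/eqP/ffunP => i; rewrite ffunE; apply: val_inj; case: (S i) => -[].
Qed.

Lemma Weq_ge0 n (f : rV n -> R) j : 0 <= Weq f j.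
Proof. by apply: sumr_ge0 => *; exact: sqr_ge0. Qed.

Lemma WleE n (f : rV n -> R) : Wle f 2 = Weq f 0 + Weq f 1 + Weq f 2.
Proof. by rewrite /Wle !big_ord_recr big_ord0 /= add0r. Qed.

Lemma gauss_exp_expR n (v : rV n) :
  gauss_exp (fun x : rV n => expR (\sum_i v 0 i * x 0 i)) = expR (sqn v / 2).
Proof.
have g i : tame1 (fun t => expR (v 0 i * t)).
  split; first by apply: measurableT_comp => //; exact: measurable_funM.
  exists (expR (v 0 i ^+ 2)) => t; rewrite ger0_norm ?expR_ge0 // -expRD ler_expR.
  have := sqr_ge0 (v 0 i - t / 2); lra.
have -> : (fun x : rV n => expR (\sum_i v 0 i * x 0 i)) = fun x => \prod_i expR (v 0 i * x 0 i).
  by apply/funext => x; rewrite expR_sum.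
rewrite (@gauss_exp_prod1 n (fun i t => expR (v 0 i * t)) g).
under eq_bigr do rewrite gauss1_expR.
by rewrite -expR_sum /sqn mulr_suml.
Qed.

Lemma gauss_exp_sqn n : gauss_exp (@sqn R n) = n%:R.
Proof.
rewrite /sqn gauss_exp_sum; last by move=> i; have := @tame_coordM n i i.
under eq_bigr => i _.
  have -> : gauss_exp (fun x : rV n => x 0 i ^+ 2) = 1.
    have g k : tame1 (fun t : R => if k == i then t ^+ 2 else 1).
      by case: eqP => _; [exact: tame1_sqr|exact: tame1_cst].
    have := gauss_exp_prod1 g.
    rewrite [RHS](bigD1 i) //= eqxx gauss1_sqr big1 ?mulr1; last first.
      by move=> k ki; rewrite (negbTE ki) gauss1_cst.
    move=> <-; congr gauss_exp; apply/funext => x; rewrite (bigD1 i) //= eqxx.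
    by rewrite big1 ?mulr1 // => k ki; rewrite (negbTE ki).
  over.
by rewrite sumr_const card_ord.
Qed.

End Coef.

(** * Separation *)

Section Sep.
Variable R : realType.
Local Notation rV n := 'rV[R]_n.

Definition dot n (u v : rV n) : R := \sum_i u 0 i * v 0 i.

Lemma dotxx n (u : rV n) : dot u u = sqn u.
Proof. by apply: eq_bigr => i _; rewrite expr2. Qed.

Lemma dotC n (u v : rV n) : dot u v = dot v u.
Proof. by apply: eq_bigr => i _; rewrite mulrC. Qed.

Lemma dotDr n (u v w : rV n) : dot u (v + w) = dot u v + dot u w.
Proof. by rewrite -big_split; apply: eq_bigr => i _; rewrite mxE mulrDr. Qed.

Lemma dotZr n a (u v : rV n) : dot u (a *: v) = a * dot u v.
Proof. by rewrite mulr_sumr; apply: eq_bigr => i _; rewrite mxE mulrCA. Qed.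

Lemma dotDl n (u v w : rV n) : dot (v + w) u = dot v u + dot w u.
Proof. by rewrite dotC dotDr !(dotC u). Qed.

Lemma dotZl n a (u v : rV n) : dot (a *: v) u = a * dot v u.
Proof. by rewrite dotC dotZr dotC. Qed.

Lemma dotNr n (u v : rV n) : dot u (- v) = - dot u v.
Proof. by rewrite -scaleN1r dotZr mulN1r. Qed.

Lemma dotNl n (u v : rV n) : dot (- v) u = - dot v u.
Proof. by rewrite dotC dotNr dotC. Qed.

Definition dotE := (dotDl, dotDr, dotNl, dotNr, dotZl, dotZr).

Lemma sqnZ n a (u : rV n) : sqn (a *: u) = a ^+ 2 * sqn u.
Proof. by rewrite -!dotxx !dotE; ring. Qed.

Lemma cl_cl n (K : set (rV n)) : cl (cl K) `<=` cl K.
Proof.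
move=> x Kx e e0; have e20 : 0 < e / 2 by rewrite divr_gt0.
have [y Ky xy] := Kx _ e20; have [z Kz yz] := Ky _ e20.
exists z => // i; apply: le_lt_trans (ler_distD (y 0 i) _ _) _.
have := xy i; have := yz i; lra.
Qed.

Lemma small_sqrt (e : R) : 0 < e -> exists k : nat, Num.sqrt (2 * k.+1%:R^-1) < e.
Proof.
move=> e0; have e2 : 0 < e ^+ 2 / 2 by rewrite divr_gt0 // exprn_gt0.
have [k _ h] := near_infty_natSinv_lt (PosNum e2).
have hk : k.+1%:R^-1 < e ^+ 2 / 2 by exact: (h k (leqnn k)).
exists k; rewrite -(ltr_pXn2r (n := 2)) ?nnegrE ?sqrtr_ge0 ?ltW //.
rewrite sqr_sqrtr; last by rewrite mulr_ge0 // invr_ge0.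
move: hk; set d := k.+1%:R^-1; lra.
Qed.

Lemma nearest_point n (C : set (rV n)) z : cvx C -> cl C `<=` C -> C !=set0 ->
  exists2 p, C p & forall x, C x -> sqn (z - p) <= sqn (z - x).
Proof.
move=> cC clC [y0 Cy0].
pose E := [set sqn (z - y) | y in C].
have hE : has_inf E.
  by split; [exists (sqn (z - y0)); exists y0|exists 0 => _ [y _ <-]; exact: sqn_ge0].
pose D := inf E.
have DC x : C x -> D <= sqn (z - x).
  by move=> Cx; apply: ge_inf; [case: hE|exists x].
(* The parallelogram law will give |u k - u l|^2 <= 2 / (k + 1) + 2 / (l + 1) = c k^2 + c l^2. *)
pose c (k : nat) := Num.sqrt (2 * k.+1%:R^-1) : R.
have d0 (k : nat) : 0 <= 2 * k.+1%:R^-1 :> R by rewrite mulr_ge0 // invr_ge0.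
have c0 k : 0 <= c k by exact: sqrtr_ge0.
have cc k : c k ^+ 2 = 2 * k.+1%:R^-1 by rewrite sqr_sqrtr.
have hu (k : nat) : exists u, C u /\ sqn (z - u) < D + k.+1%:R^-1.
  have k0 : 0 < k.+1%:R^-1 :> R by rewrite invr_gt0.
  by have [_ [u Cu <-] h] := inf_adherent k0 hE; exists u.
(* A minimizing sequence is Cauchy by the parallelogram law. *)
have {hu}[u hu] := choice hu.
have uC k : C (u k) by case: (hu k).
have uD k : sqn (z - u k) < D + k.+1%:R^-1 by case: (hu k).
have ucc k l i : `|u k 0 i - u l 0 i| <= c k + c l.
  have hm : C (2^-1 *: u k + (1 - 2^-1) *: u l) by apply: cC => //; lra.
  have := DC _ hm; have := uD k; have := uD l.
  have := sqr_le_sqn (u k - u l) i; rewrite !mxE -!dotxx !dotE.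
  rewrite (dotC (u k) z) (dotC (u l) z) (dotC (u l) (u k)) => h1 h2 h3 h4.
  rewrite -(@ler_pXn2r _ 2) ?nnegrE ?addr_ge0 // real_normK ?num_real //.
  rewrite [(c k + c l) ^+ 2]sqrrD !cc; have := mulr_ge0 (c0 k) (c0 l).
  move: h1 h2 h3 h4; set dk := k.+1%:R^-1; set dl := l.+1%:R^-1; lra.
(* The intervals [u k - c k, u k + c k] meet pairwise; p is a common point. *)
pose p : rV n := \row_i sup (range (fun k => u k 0 i - c k)).
have pu i k : `|p 0 i - u k 0 i| <= c k.
  have ub l : ubound (range (fun k => u k 0 i - c k)) (u l 0 i + c l).
    by move=> _ [m _ <-]; have := ucc m l i; rewrite ler_norml; lra.
  rewrite mxE ler_norml; apply/andP; split.
    have : u k 0 i - c k <= sup (range (fun k => u k 0 i - c k)).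
      by apply: ub_le_sup; [exists (u k 0 i + c k)|exists k].
    lra.
  have : sup (range (fun k => u k 0 i - c k)) <= u k 0 i + c k.
    by apply: ge_sup => //; exists (u 0%N 0 i - c 0%N); exists 0%N.
  lra.
have Cp : C p.
  apply: clC => e e0; have [k hk] := small_sqrt e0.
  by exists (u k) => // i; apply: le_lt_trans (pu i k) hk.
exists p => // x Cx; apply: le_trans (DC _ Cx).
(* Replacing u k by p moves each coordinate of z - u k, of size at most D + 2, by at most c k <= 2,
   so its square grows by at most (2 (D + 2) + 2) c k. *)
pose M := \sum_(i < n) (2 * (D + 2) + 2).
have D0 : 0 <= D by apply: lb_le_inf; [case: hE|move=> _ [y _ <-]; exact: sqn_ge0].
have M0 : 0 <= M by apply: sumr_ge0 => i _; lra.
have pk k : sqn (z - p) <= D + (M + 1) * c k.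
  have k1 : k.+1%:R^-1 <= 1 :> R by rewrite invf_le1 // ler1n.
  have k0 : 0 <= k.+1%:R^-1 :> R by rewrite invr_ge0.
  have ck2 : c k <= 2.
    rewrite -(@ler_pXn2r _ 2) ?nnegrE // cc.
    by move: k1 k0; set d := k.+1%:R^-1; lra.
  have kc : k.+1%:R^-1 <= c k.
    rewrite -(@ler_pXn2r _ 2) ?nnegrE // cc.
    by move: k1 k0; set d := k.+1%:R^-1; nra.
  apply: (@le_trans _ _ (sqn (z - u k) + M * c k)); last first.
    by have := uD k; move: kc; set d := k.+1%:R^-1; lra.
  rewrite /sqn /M mulr_suml -big_split; apply: ler_sum => i _ /=; rewrite !mxE.
  have h1 := pu i k; rewrite mxE in h1.
  have h2 : `|z 0 i - u k 0 i| <= D + 2.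
    have := sqr_le_sqn (z - u k) i; rewrite !mxE -(real_normK (num_real (z 0 i - u k 0 i))) => h.
    have := uD k; move: k1; set d := k.+1%:R^-1.
    by have := normr_ge0 (z 0 i - u k 0 i); nra.
  move: h1 h2; set q := sup _; set a := z 0 i; set b := u k 0 i; set s := c k.
  have s0 : 0 <= s by exact: c0.
  have s2 : s <= 2 by [].
  rewrite !ler_norml => /andP[h1 h2] /andP[h3 h4]; nra.
rewrite leNgt; apply/negP => h.
have M1 : 0 < M + 1 by lra.
have e0 : 0 < (sqn (z - p) - D) / (M + 1) by rewrite divr_gt0 // subr_gt0.
have [k] := small_sqrt e0; rewrite -/(c k) ltr_pdivlMr // => hk.
have := pk k; lra.
Qed.

(** The normal is z - p with p nearest to z: moving from p a little towards x in C cannot decrease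
    the distance to z, so (z - p).(x - p) <= 0. *)
Lemma separation n (C : set (rV n)) z : cvx C -> cl C `<=` C -> C !=set0 -> ~ C z ->
  exists2 v, sqn v = 1 & forall x, C x -> dot v x <= dot v z.
Proof.
move=> cC clC C0 nCz; have [p Cp hp] := nearest_point z cC clC C0.
pose w := z - p; pose D := sqn w.
have D0 : 0 < D.
  rewrite lt_def; apply/andP; split; last exact: sqn_ge0.
  apply/eqP => Dz; apply: nCz.
  suff -> : z = p by [].
  apply/rowP => i; apply/eqP; rewrite -subr_eq0 -sqrf_eq0 eq_le sqr_ge0 andbT.
  by have := sqr_le_sqn w i; rewrite -/D Dz !mxE.
have wx x : C x -> dot w (x - p) <= 0.
  move=> Cx; rewrite leNgt; apply/negP => h.
  have hs s : 0 < s -> s <= 1 -> 2 * dot w (x - p) <= s * sqn (x - p).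
    move=> s0 s1; have Cs : C (s *: x + (1 - s) *: p) by apply: cC => //; exact: ltW.
    have := hp _ Cs.
    have -> : z - (s *: x + (1 - s) *: p) = w - s *: (x - p).
      by apply/rowP => i; rewrite !mxE; ring.
    rewrite -/w -!dotxx; move: (x - p) (w) => y w'; rewrite !dotE (dotC y w').
    move=> h'; have : 0 <= s * (s * dot y y - 2 * dot w' y) by lra.
    by rewrite pmulr_rge0 // subr_ge0.
  pose N := sqn (x - p); have N0 : 0 <= N by exact: sqn_ge0.
  (* With t = w.(x - p) > 0, the step s = t / (t + N + 1) satisfies s N < t, against 2 t <= s N. *)
  have q0 : 0 < dot w (x - p) / (dot w (x - p) + N + 1).
    by rewrite divr_gt0 //; lra.
  have q1 : dot w (x - p) / (dot w (x - p) + N + 1) <= 1.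
    by rewrite ler_pdivrMr; lra.
  have := hs _ q0 q1; rewrite -/N mulrAC ler_pdivlMr; last lra.
  move: h; set t := dot _ _ => h; nra.
have sD : 0 < Num.sqrt D by rewrite sqrtr_gt0.
exists ((Num.sqrt D)^-1 *: w).
  by rewrite sqnZ -/D exprVn sqr_sqrtr ?ltW // mulVf // gt_eqF.
move=> x Cx; rewrite !dotZl ler_wpM2l ?invr_ge0 ?sqrtr_ge0 //.
have := wx x Cx; rewrite dotDr dotNr => h.
have : dot w z - dot w p = D by rewrite -dotNr -dotDr dotxx.
by move: D0; lra.
Qed.

End Sep.

(** * Short vectors belong to the closure when the low-degree weight is small *)

Section Separated.
Variable R : realType.
Local Notation rV n := 'rV[R]_n.

Lemma tame_ind1 n (K : set (rV n)) : tame (ind (cl K)).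
Proof.
have := tame_ind K (tame_cst n 1).
by rewrite (_ : (fun x => _) = ind (cl K)) //; apply/funext => x; rewrite mulr1.
Qed.

Lemma gauss_exp_ind_le1 n (K : set (rV n)) : gauss_exp (ind (cl K)) <= 1.
Proof.
rewrite -[leRHS](gauss_exp_cst n); apply: gauss_exp_le; [exact: tame_ind1|exact: tame_cst|].
by move=> x; case/andP: (ind_bound (cl K) x).
Qed.

(** The linear term suffices up to 64; beyond, exp y >= y^4 / 256 >= 16 y^2, as 64^2 = 16 * 256. The
    divisor 16 later keeps the exponential moment well below the measure of K. *)
Lemma sqr_le_affine_expR (y : R) : 0 <= y -> y ^+ 2 <= 64 * y + expR y / 16.
Proof.
move=> y0; have [h|h] := leP y 64.
  have : 0 <= expR y / 16 by rewrite divr_ge0 ?expR_ge0.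
  nra.
have := expR_ge_poly4 y0 => h4.
have : y ^+ 2 * 4096 <= y ^+ 4.
  rewrite (_ : y ^+ 4 = y ^+ 2 * y ^+ 2); last by ring.
  by rewrite ler_wpM2l ?sqr_ge0 //; nra.
have : (y / 4) ^+ 4 = y ^+ 4 / 256 by field.
lra.
Qed.

Lemma dot_sqr_le n (v z : rV n) r : sqn v = 1 -> 0 < r -> sqn z <= r ^+ 2 ->
  `|dot v z| <= r.
Proof.
move=> v1 r0 zr.
have h1 : 0 <= sqn (r *: v - z) by exact: sqn_ge0.
have h2 : 0 <= sqn (r *: v + z) by exact: sqn_ge0.
move: h1 h2; rewrite -!dotxx !dotE !dotxx v1 (dotC z v) ler_norml => h1 h2.
have [k1 k2] : r * (2 * dot v z) <= r * (2 * r) /\ r * (2 * - dot v z) <= r * (2 * r) by lra.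
by move: k1 k2; rewrite !(ler_pM2l r0) => k1 k2; apply/andP; split; lra.
Qed.

Lemma tame_ind_dot n (K : set (rV n)) v : tame (fun x => ind (cl K) x * dot v x).
Proof.
apply: tame_ind; apply: tame_sum => i; apply: tameZ; exact: tame_coord.
Qed.

Lemma dot_sqrE n (v x : rV n) :
  dot v x ^+ 2 = \sum_j \sum_l v 0 j * v 0 l * (x 0 j * x 0 l).
Proof.
rewrite expr2 /dot mulr_suml; apply: eq_bigr => j _; rewrite mulr_sumr.
by apply: eq_bigr => l _; ring.
Qed.

Lemma tame_dot_sqr n (v : rV n) : tame (fun x => dot v x ^+ 2).
Proof.
have -> : (fun x => dot v x ^+ 2) = fun x : rV n => \sum_j \sum_l v 0 j * v 0 l * (x 0 j * x 0 l).
  by apply/funext => x; rewrite dot_sqrE.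
by apply: tame_sum => j; apply: tame_sum => l; apply: tameZ; exact: tame_coordM.
Qed.

Lemma tame_expR_dot n (v : rV n) : tame (fun x => expR (dot v x)).
Proof.
split.
  apply: borel_comp => //; apply: borel_sum => i.
  by apply: borelM; [exact: borel_cst|exact: borel_coord].
exists (expR (sqn v)) => x; rewrite ger0_norm ?expR_ge0 // -expRD ler_expR.
have : 0 <= sqn (v - 2^-1 *: x) by exact: sqn_ge0.
rewrite -!dotxx !dotE !dotxx (dotC x v); lra.
Qed.

(** Each |v_j| is at most 1, so n errors of size e / n add up to at most e. *)
Lemma gauss_exp_ind_dot n (K : set (rV n)) v e : sqn v = 1 ->
  (forall j, `|gauss_exp (fun x => ind (cl K) x * x 0 j)| <= e / n%:R) ->
  `|gauss_exp (fun x => ind (cl K) x * dot v x)| <= e.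
Proof.
move=> v1 h.
have -> : (fun x => ind (cl K) x * dot v x) = fun x => \sum_j v 0 j * (ind (cl K) x * x 0 j).
  by apply/funext => x; rewrite mulr_sumr; apply: eq_bigr => j _; rewrite mulrCA.
rewrite gauss_exp_sum; last by move=> j; apply/tameZ/tame_ind/tame_coord.
have [n0|n0] := posnP n.
  by subst n; move: v1; rewrite /sqn big_ord0 => /esym/eqP; rewrite oner_eq0.
have nn : n%:R != 0 :> R by rewrite pnatr_eq0 -lt0n.
apply: le_trans (ler_norm_sum _ _ _) _.
have -> : e = \sum_(j < n) (e / n%:R).
  by rewrite sumr_const card_ord -[RHS]mulr_natr divfK.
apply: ler_sum => j _; rewrite gauss_expZ; last by apply/tame_ind/tame_coord.
rewrite normrM -[leRHS]mul1r ler_pM //.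
have := sqr_le_sqn v j; rewrite v1 -(real_normK (num_real (v 0 j))).
by rewrite -[X in _ <= X](expr1n _ 2) ler_pXn2r ?nnegrE.
Qed.

(** The weights |v_j v_l| <= (v_j^2 + v_l^2) / 2 sum to at most n over all pairs, which the error e
    / n per entry absorbs. *)
Lemma gauss_exp_ind_dot_sqr n (K : set (rV n)) v p e : sqn v = 1 ->
  (forall j l, `|gauss_exp (fun x => ind (cl K) x * (x 0 j * x 0 l)) - (j == l)%:R * p| <= e / n%:R) ->
  `|gauss_exp (fun x => ind (cl K) x * dot v x ^+ 2) - p| <= e.
Proof.
move=> v1 h.
have [n0|n0] := posnP n.
  by subst n; move: v1; rewrite /sqn big_ord0 => /esym/eqP; rewrite oner_eq0.
have nn : n%:R != 0 :> R by rewrite pnatr_eq0 -lt0n.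
have -> : (fun x => ind (cl K) x * dot v x ^+ 2) = fun x => \sum_j \sum_l v 0 j * v 0 l * (ind (cl K) x * (x 0 j * x 0 l)).
  apply/funext => x; rewrite dot_sqrE mulr_sumr; apply: eq_bigr => j _.
  by rewrite mulr_sumr; apply: eq_bigr => l _; rewrite mulrCA.
have gjl j l : tame (fun x => ind (cl K) x * (x 0 j * x 0 l)) by apply/tame_ind/tame_coordM.
rewrite gauss_exp_sum; last by move=> j; apply: tame_sum => l; exact: tameZ.
have -> : p = \sum_(j < n) \sum_(l < n) v 0 j * v 0 l * ((j == l)%:R * p).
  rewrite -[LHS]mul1r -[in LHS]v1 /sqn mulr_suml; apply: eq_bigr => j _.
  rewrite (bigD1 j) //= eqxx mul1r big1 ?addr0 ?expr2 // => l lj.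
  by rewrite eq_sym (negbTE lj) mul0r mulr0.
rewrite -sumrB.
have -> : e = \sum_(j < n) \sum_(l < n) ((v 0 j ^+ 2 + v 0 l ^+ 2) / 2 * (e / n%:R)).
  transitivity (\sum_(j < n) ((v 0 j ^+ 2 * n%:R + 1) / 2 * (e / n%:R))).
    rewrite -mulr_suml -mulr_suml big_split /= -mulr_suml -/(sqn v) v1.
    by rewrite sumr_const card_ord; field.
  apply: eq_bigr => j _; rewrite -mulr_suml -mulr_suml big_split /= -/(sqn v) v1.
  by rewrite sumr_const card_ord mulr_natr.
apply: le_trans (ler_norm_sum _ _ _) _; apply: ler_sum => j _.
rewrite gauss_exp_sum; last by move=> l; exact: tameZ.
rewrite -sumrB; apply: le_trans (ler_norm_sum _ _ _) _; apply: ler_sum => l _.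
rewrite gauss_expZ // -mulrBr normrM ler_pM // normrM.
rewrite -(real_normK (num_real (v 0 j))) -(real_normK (num_real (v 0 l))).
have := sqr_ge0 (`|v 0 j| - `|v 0 l|); nra.
Qed.

(* X = v.z - v.x is nonnegative on K with E[1_K X] small and E[1_K X^2] ~ p,
   against X^2 <= 64 X + exp(X) / 16. *)
Lemma short_vector_in_cl n (K : set (rV n)) z p e : cvx K ->
  p = gauss_exp (ind (cl K)) -> 49 / 100 <= p -> e <= 1 / 1000 ->
  (forall j, `|gauss_exp (fun x => ind (cl K) x * x 0 j)| <= e / n%:R) ->
  (forall j l, `|gauss_exp (fun x => ind (cl K) x * (x 0 j * x 0 l)) - (j == l)%:R * p| <= e / n%:R) ->
  sqn z <= (1 / 1000) ^+ 2 -> cl K z.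
Proof.
move=> cK pE p49 e1 h1 h2 zr; apply: contrapT => nCz.
have p1 : p <= 1 by rewrite pE; exact: gauss_exp_ind_le1.
have C0 : cl K !=set0.
  apply: contrapT => hC; have : p = 0; last lra.
  rewrite pE -[RHS](gauss_exp_cst n); congr gauss_exp; apply/funext => x.
  rewrite /ind; case: asboolP => // Kx; case: hC; by exists x.
have [v v1 hv] := separation (cvx_cl cK) (@cl_cl _ _ K) C0 nCz.
pose r := dot v z.
have rb : `|r| <= 1 / 1000 by apply: (dot_sqr_le v1 _ zr); lra.
have b1 := gauss_exp_ind_dot v1 h1.
have b2 := gauss_exp_ind_dot_sqr v1 h2.
have gi := tame_ind1 K.
have gd := tame_ind_dot K v.
have gd2 : tame (fun x => ind (cl K) x * dot v x ^+ 2) by exact/tame_ind/tame_dot_sqr.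
have ge := tame_expR_dot (- v).
have vN1 : sqn (- v) = 1 by rewrite -scaleN1r sqnZ sqrrN expr1n mul1r.
have EE : gauss_exp (fun x => expR (dot (- v) x)) = expR (1 / 2) by rewrite gauss_exp_expR vN1.
(* The exponential carries no indicator: its mean is then explicit, and off the closure it only
   enlarges the right side. *)
have main : gauss_exp (fun x => r ^+ 2 * ind (cl K) x + (- (2 * r) * (ind (cl K) x * dot v x)
    + ind (cl K) x * dot v x ^+ 2)) <=
  gauss_exp (fun x => (64 * r) * ind (cl K) x + (- 64 * (ind (cl K) x * dot v x)
    + expR r / 16 * expR (dot (- v) x))).
  apply: gauss_exp_le.
  - by apply: tameD; [exact: tameZ|apply: tameD => //; exact: tameZ].
  - by apply: tameD; [exact: tameZ|apply: tameD; exact: tameZ].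
  move=> x; rewrite /ind; case: asboolP => [Cx|_] /=; last first.
    rewrite !(mulr0, mul0r) !add0r mulr_ge0 ?expR_ge0 // divr_ge0 ?expR_ge0 //.
  have := hv _ Cx; rewrite -/r => hr.
  have y0 : 0 <= r - dot v x by lra.
  have := sqr_le_affine_expR y0.
  by rewrite expRD dotNl; lra.
move: main; rewrite gauss_expD; [|exact: tameZ|by apply: tameD => //; exact: tameZ].
rewrite gauss_expD; [|exact: tameZ|by []].
rewrite gauss_expD; [|exact: tameZ|by apply: tameD; exact: tameZ].
rewrite gauss_expD; [|exact: tameZ|exact: tameZ].
rewrite !gauss_expZ // -pE EE [expR r / 16 * _]mulrAC -expRD.
have e3 : expR (r + 1 / 2) <= 3.
  have h : 1 - (r + 1 / 2) <= expR (- (r + 1 / 2)) by have := expR_ge1Dx (- (r + 1 / 2)); lra.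
  rewrite -[leLHS]invrK -expRN.
  have h49 : 49 / 100 <= expR (- (r + 1 / 2)).
    by move: rb; rewrite ler_norml; lra.
  rewrite invf_ple ?posrE ?expR_gt0 //; apply: le_trans h49; lra.
move: b1 b2 rb; set a := gauss_exp _; set b := gauss_exp _; set E := expR _ in e3 *.
have r2 := sqr_ge0 r.
rewrite !ler_norml => /andP[a1 a2] /andP[b1 b2] /andP[r1 r3].
(* Since |r|, |a| and |b - p| are at most 1/1000, the left side is at least 0.488, while the right
   side is at most 0.064 + 0.064 + 3/16 < 0.32. *)
have t1 : 2 * r * a <= 1 / 1000 by nra.
have t2 : r * p <= 1 / 1000 by nra.
have t3 : 0 <= r ^+ 2 * p by rewrite mulr_ge0 //; lra.
lra.
Qed.

End Separated.

(** * Isoperimetry by rotation *)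

Section Shrinking.
Variable R : realType.
Local Notation rV n := 'rV[R]_n.

(* Rational parametrization of the quarter circle from (1, 0) at 0 to (0, 1) at 1. *)
Definition rotc (t : R) : R := (1 - t ^+ 2) / (1 + t ^+ 2).
Definition rots (t : R) : R := 2 * t / (1 + t ^+ 2).

Lemma den_gt0 (t : R) : 0 < 1 + t ^+ 2.
Proof. by have := sqr_ge0 t; lra. Qed.

Lemma rot_unit t : rotc t ^+ 2 + rots t ^+ 2 = 1.
Proof. by rewrite /rotc /rots; field; rewrite gt_eqF // den_gt0. Qed.

(** The squared chord is exactly 4 (s - t)^2 / ((1 + s^2) (1 + t^2)), so sampling at multiples of 1
    / N gives chords of length at most 2 / N. *)
Lemma rot_chord s t :
  (rotc s - rotc t) ^+ 2 + (rots s - rots t) ^+ 2 <= 4 * (s - t) ^+ 2.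
Proof.
have ds := den_gt0 s; have dt := den_gt0 t.
have -> : (rotc s - rotc t) ^+ 2 + (rots s - rots t) ^+ 2 =
    4 * (s - t) ^+ 2 / ((1 + s ^+ 2) * (1 + t ^+ 2)).
  by rewrite /rotc /rots; field; rewrite !gt_eqF.
rewrite ler_pdivrMr ?mulr_gt0 // -[leLHS]mulr1 ler_wpM2l //.
  by rewrite mulr_ge0 // sqr_ge0.
have := sqr_ge0 s; have := sqr_ge0 t; nra.
Qed.

Lemma sqn_comb_le n a b (x y : rV n) :
  sqn (a *: x + b *: y) <= (a ^+ 2 + b ^+ 2) * (sqn x + sqn y).
Proof.
rewrite /sqn -big_split mulr_sumr; apply: ler_sum => i _ /=; rewrite !mxE.
have := sqr_ge0 (a * y 0 i - b * x 0 i); nra.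
Qed.

Lemma sqr_sum_le n (a : 'I_n -> R) : (\sum_j a j) ^+ 2 <= n%:R * \sum_j a j ^+ 2.
Proof.
case: n a => [|n] a; first by rewrite !big_ord0 expr0n mulr0.
set S := \sum_j a j; set Q := \sum_j a j ^+ 2; set N := n.+1%:R.
have N0 : 0 < N by rewrite ltr0n.
have : 0 <= sqn (N *: \row_j a j - S *: const_mx 1 : rV n.+1) by exact: sqn_ge0.
have -> : sqn (N *: \row_j a j - S *: const_mx 1 : rV n.+1) = N * (N * Q - S ^+ 2).
  rewrite -dotxx !dotE !dotxx.
  have -> : sqn (\row_j a j) = Q by apply: eq_bigr => j _; rewrite mxE.
  have -> : sqn (const_mx 1 : rV n.+1) = N.
    rewrite /sqn (eq_bigr (fun=> 1)) ?sumr_const ?card_ord // => j _.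
    by rewrite mxE expr1n.
  have -> : dot (const_mx 1) (\row_j a j) = S.
    by apply: eq_bigr => j _; rewrite !mxE mul1r.
  have -> : dot (\row_j a j) (const_mx 1) = S.
    by apply: eq_bigr => j _; rewrite !mxE mulr1.
  ring.
by rewrite pmulr_rge0 // subr_ge0.
Qed.

Section Shrink.
Variables (n : nat) (K : set (rV n)) (r l : R).
Hypothesis cK : cvx K.
Hypothesis l01 : 0 < l < 1.
Hypothesis ballK : forall z, sqn z <= r ^+ 2 -> cl K z.

Let i := ind (cl K).
Let iL x := ind (cl K) (l^-1 *: x).

(** x' is the convex combination, with weights l and 1 - l, of x / l and (x' - x) / (1 - l); the
    latter lies in the ball of radius r. *)
Lemma shrink_step (x x' : rV n) : cl K (l^-1 *: x) ->
  sqn (x' - x) <= ((1 - l) * r) ^+ 2 -> cl K x'.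
Proof.
case/andP: l01 => l0 l1 Kx xx'.
have l10 : 0 < 1 - l by lra.
have -> : x' = l *: (l^-1 *: x) + (1 - l) *: ((1 - l)^-1 *: (x' - x)).
  by rewrite !scalerA !mulfV ?gt_eqF // !scale1r addrC subrK.
apply: (cvx_cl cK) => //; try exact: ltW.
apply: ballK; rewrite sqnZ exprVn mulrC ler_pdivrMr ?exprn_gt0 //.
by rewrite mulrC -exprMn.
Qed.

Lemma shrink_le x : iL x <= i x.
Proof.
rewrite /iL /i /ind; case: asboolP => // Kx; case: asboolP => // nKx.
case: nKx; apply: (shrink_step Kx); rewrite subrr.
by rewrite /sqn big1 ?sqr_ge0 // => j _; rewrite mxE expr0n.
Qed.

(** If the path starts in l K and ends outside, the first point outside l K is still in K because
    the step to it is short, so its term equals 1. The sum starts at k = 1: the starting point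
    contributes nothing, and the later rotations have the positive sine that [gauss_exp_conv]
    requires. *)
Lemma shrink_chain (x y : rV n) (N : nat) D : (0 < N)%N ->
  sqn x + sqn y <= D -> 4 / N%:R ^+ 2 * D <= ((1 - l) * r) ^+ 2 ->
  iL x * (1 - iL y) <=
  \sum_(k < N) (i (rotc (k.+1%:R / N%:R) *: x + rots (k.+1%:R / N%:R) *: y)
              - iL (rotc (k.+1%:R / N%:R) *: x + rots (k.+1%:R / N%:R) *: y)).
Proof.
move=> N0 xyD hD; pose X (k : nat) := rotc (k%:R / N%:R) *: x + rots (k%:R / N%:R) *: y.
have NR : 0 < N%:R :> R by rewrite ltr0n.
have step k : sqn (X k.+1 - X k) <= ((1 - l) * r) ^+ 2.
  apply: le_trans hD.
  have -> : X k.+1 - X k = (rotc (k.+1%:R / N%:R) - rotc (k%:R / N%:R)) *: x +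
      (rots (k.+1%:R / N%:R) - rots (k%:R / N%:R)) *: y.
    by apply/rowP => j; rewrite !mxE; ring.
  apply: le_trans (sqn_comb_le _ _ _ _) _.
  apply: ler_pM => //; rewrite ?addr_ge0 ?sqr_ge0 ?sqn_ge0 //.
  apply: le_trans (rot_chord _ _) _.
  have -> : k.+1%:R / N%:R - k%:R / N%:R = N%:R^-1 :> R.
    by rewrite -mulrBl -[k.+1]addn1 natrD addrC addKr mul1r.
  by rewrite exprVn.
have D0 k : 0 <= i (X k) - iL (X k) by rewrite subr_ge0 shrink_le.
have S0 : 0 <= \sum_(k < N) (i (X k.+1) - iL (X k.+1)) by apply: sumr_ge0 => k _.
rewrite {1}/iL {1}/ind; case: asboolP => Lx; last by rewrite mul0r.
rewrite mul1r {1}/iL {1}/ind; case: asboolP => Ly; first by rewrite subrr.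
rewrite subr0 leNgt; apply/negP => small; apply: Ly.
(* With every term 0 or 1 and the sum below 1, no point leaves l K, contradicting the position of
   y. *)
have all k : (k <= N)%N -> cl K (l^-1 *: X k).
  elim: k => [_|k IH kN].
    rewrite /X mul0r /rotc /rots expr0n /= mulr0 mul0r subr0 addr0 divr1.
    by rewrite scale1r scale0r addr0.
  have CX := shrink_step (IH (ltnW kN)) (step k).
  apply: contrapT => nLX; move: small; apply/negP; rewrite -leNgt.
  rewrite (bigD1 (Ordinal kN)) //= -/(X k.+1).
  have -> : i (X k.+1) - iL (X k.+1) = 1.
    rewrite /i /iL /ind; case: asboolP => // _; case: asboolP => // _.
    by rewrite subr0.
  by rewrite lerDl; apply: sumr_ge0 => j _; exact: D0.
have := all N (leqnn N); rewrite /X divff ?gt_eqF // /rotc /rots expr1n subrr mul0r.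
by rewrite mulr1 divff ?gt_eqF // scale0r add0r scale1r.
Qed.

Lemma borel_iL : borel iL.
Proof. apply: borel_scale; exact: borel_ind_cl. Qed.

Lemma tame_iL : tame iL.
Proof.
apply: (@tame_bd _ _ _ 1); first exact: borel_iL.
by move=> x; have /andP[? ?] := ind_bound (cl K) (l^-1 *: x); rewrite ger0_norm.
Qed.

(** Integrate [shrink_chain] over independent pairs: every term on the arc has the mean of i - iL by
    rotation invariance. Pairs with |z|^2 > 16 n are covered by adding |z|^2 / (16 n), whose mean is
    2 n / (16 n) = 1/8. *)
Lemma shrink_isoperimetry (N : nat) : (0 < N)%N -> (0 < n)%N ->
  4 / N%:R ^+ 2 * (16 * n%:R) <= ((1 - l) * r) ^+ 2 ->
  gauss_exp iL * (1 - gauss_exp iL) <= N%:R * (gauss_exp i - gauss_exp iL) + 1 / 8.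
Proof.
move=> N0 n0 hN; have nR : 0 < n%:R :> R by rewrite ltr0n.
have NR : 0 < N%:R :> R by rewrite ltr0n.
have gi : tame i by exact: tame_ind1.
have giL := tame_iL.
have g1 : tame (fun x => 1 + -1 * iL x) by apply: tameD; [exact: tame_cst|exact: tameZ].
have E1 : gauss_exp (fun x => 1 + -1 * iL x) = 1 - gauss_exp iL.
  by rewrite gauss_expD ?gauss_exp_cst ?gauss_expZ ?mulN1r //; [exact: tame_cst|exact: tameZ].
pose D x := i x + -1 * iL x.
have DE : gauss_exp D = gauss_exp i - gauss_exp iL.
  by rewrite gauss_expD ?gauss_expZ ?mulN1r //; exact: tameZ.
have gD : tame D by apply: tameD => //; exact: tameZ.
have D01 x : 0 <= D x <= 1.
  have := shrink_le x; have /andP[? ?] := ind_bound (cl K) x.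
  have /andP[? ?] := ind_bound (cl K) (l^-1 *: x).
  by rewrite /D /i /iL => ?; apply/andP; split; lra.
pose Z k (z : rV n.*2) := D (rotc (k.+1%:R / N%:R) *: evens z + rots (k.+1%:R / N%:R) *: odds z).
have bZ k : borel (Z k) by apply: (@borel_pair R n D); case: gD.
have gZ k : tame (Z k).
  by apply: (@tame_bd _ _ _ 1) => // z; have /andP[? ?] := D01 (rotc (k.+1%:R / N%:R) *: evens z + rots (k.+1%:R / N%:R) *: odds z); rewrite ger0_norm.
have EZ k : gauss_exp (Z k) = gauss_exp D.
  apply: (@gauss_exp_conv _ _ _ 1) => //.
  - by rewrite /rots divr_gt0 ?den_gt0 // mulr_gt0 // divr_gt0.
  - exact: rot_unit.
  - by case: gD.
have gsq : tame (fun z : rV n.*2 => (16 * n%:R)^-1 * sqn z) by apply/tameZ/tame_sqn.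
have gprod : tame (fun z : rV n.*2 => iL (evens z) * (1 + -1 * iL (odds z))).
  apply: (@tame_bd _ _ _ 1).
    apply: borelM.
      have -> : (fun z : rV n.*2 => iL (evens z)) = fun z => iL (1 *: evens z + 0 *: odds z).
        by apply/funext => z; rewrite scale1r scale0r addr0.
      exact: (borel_pair _ _ borel_iL).
    have -> : (fun z : rV n.*2 => 1 + -1 * iL (odds z)) =
        fun z => (fun x => 1 + -1 * iL x) (0 *: evens z + 1 *: odds z).
      by apply/funext => z; rewrite scale1r scale0r add0r.
    by apply: (@borel_pair R n (fun x => 1 + -1 * iL x)); case: g1.
  move=> z; have /andP[? ?] := ind_bound (cl K) (l^-1 *: evens z).
  have /andP[? ?] := ind_bound (cl K) (l^-1 *: odds z).
  rewrite normrM mulr_ile1 //; rewrite ger0_norm /iL; lra.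
rewrite -E1 -(gauss_exp_pair_mul giL g1).
have -> : N%:R * (gauss_exp i - gauss_exp iL) + 1 / 8 =
    gauss_exp (fun z : rV n.*2 => \sum_(k < N) Z k z + (16 * n%:R)^-1 * sqn z).
  rewrite gauss_expD //; last exact: tame_sum.
  rewrite gauss_exp_sum // gauss_expZ; last exact: tame_sqn.
  rewrite gauss_exp_sqn (eq_bigr (fun=> gauss_exp D)) // sumr_const card_ord.
  rewrite DE mulr_natl -muln2 natrM; congr (_ + _).
  by field; rewrite gt_eqF.
apply: gauss_exp_le => //; first by apply: tameD => //; exact: tame_sum.
move=> z; have /andP[e0 e1] := ind_bound (cl K) (l^-1 *: evens z).
have /andP[t0 t1] := ind_bound (cl K) (l^-1 *: odds z).
have q0 : 0 <= (16 * n%:R)^-1 * sqn z.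
  by rewrite mulr_ge0 ?sqn_ge0 // invr_ge0 mulr_ge0.
have Z0 : 0 <= \sum_(k < N) Z k z by apply: sumr_ge0 => k _; case/andP: (D01 (rotc (k.+1%:R / N%:R) *: evens z + rots (k.+1%:R / N%:R) *: odds z)).
have [h|h] := leP (sqn z) (16 * n%:R).
  apply: (@le_trans _ _ (\sum_(k < N) Z k z)); last by rewrite lerDl.
  rewrite sqn_evens_odds in h.
  have := shrink_chain N0 h hN => hc; rewrite mulN1r; apply: (le_trans hc).
  by rewrite le_eqVlt; apply/orP; left; apply/eqP; apply: eq_bigr => k _; rewrite /Z /D mulN1r.
apply: (@le_trans _ _ 1); first by rewrite /iL; nra.
have : 1 <= (16 * n%:R)^-1 * sqn z.
  by rewrite mulrC ler_pdivlMr ?mul1r ?mulr_gt0 // ltW.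
lra.
Qed.

(** The measure of l K is the mean of 1_K exp(- n e + b |x|^2), bounded below through exp y >= 1 +
    y. The first-order term is b times the quantity inside the absolute value; replacing e by b
    costs n (e - b) <= 2 n e^2. *)
Lemma shrink_measure_ge e : l = expR (- e) -> 0 < e -> e <= 1 / 4 ->
  gauss_exp i - gauss_exp iL <=
  2 * n%:R * e ^+ 2 + e * `|n%:R * gauss_exp i - gauss_exp (fun x => i x * sqn x)|.
Proof.
move=> lE e0 e4; case/andP: l01 => l0 l1.
set A := n%:R * _ - _.
pose b := (1 - l ^+ 2) / 2.
have l2E : l ^+ 2 = expR (- (2 * e)).
  by rewrite lE -expRM_natl; congr expR; ring.
have l2lb : 1 - 2 * e <= l ^+ 2.
  by rewrite l2E; have := expR_ge1Dx (- (2 * e)); lra.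
have l2ub : l ^+ 2 <= 1 - 2 * e + 4 * e ^+ 2.
  have : expR (2 * e) * l ^+ 2 = 1 by rewrite l2E -expRD subrr expR0.
  have := expR_ge1Dx (2 * e); have := sqr_ge0 l.
  set x := expR _ => h1 h2 h3.
  have : (1 + 2 * e) * l ^+ 2 <= x * l ^+ 2 by rewrite ler_wpM2r.
  rewrite h3 => h4.
  nra.
have be : b <= e by rewrite /b; lra.
have eb : e - b <= 2 * e ^+ 2 by rewrite /b; lra.
have b0 : 0 <= b by rewrite /b; nra.
have gi : tame i by exact: tame_ind1.
have gis : tame (fun x => i x * sqn x) by exact/tame_ind/tame_sqn.
have gw : tame (fun x => expR (b * sqn x)).
  split.
    apply: (@borel_comp _ (fun t => expR (b * t))); last exact: borel_sqn.
    by apply: measurableT_comp => //; exact: measurable_funM.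
  exists 1 => x; rewrite mul1r ger0_norm ?expR_ge0 // ler_expR [leRHS]mulrC.
  by rewrite ler_wpM2r ?sqn_ge0 //; lra.
have giw : tame (fun x => i x * expR (b * sqn x)) by exact: tame_ind.
have qE : gauss_exp iL = l ^+ n * gauss_exp (fun x => i x * expR (b * sqn x)).
  apply: (@gauss_exp_scale _ _ _ _ 1) => //.
  - lra.
  - exact: borel_ind_cl.
  - by move=> x; exact: ind_bound.
have : gauss_exp (fun x => (1 - n%:R * e) * i x + b * (i x * sqn x)) <= gauss_exp iL.
  rewrite qE -gauss_expZ //; apply: gauss_exp_le.
  - by apply: tameD; exact: tameZ.
  - exact: tameZ.
  move=> x; have /andP[i0 _] := ind_bound (cl K) x.
  have -> : l ^+ n * (i x * expR (b * sqn x)) = i x * expR (- (n%:R * e) + b * sqn x).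
    by rewrite expRD lE -expRM_natl mulrN; ring.
  have := expR_ge1Dx (- (n%:R * e) + b * sqn x) => h.
  have -> : (1 - n%:R * e) * i x + b * (i x * sqn x) =
    i x * (1 + (- (n%:R * e) + b * sqn x)) by ring.
  by rewrite ler_wpM2l.
rewrite gauss_expD; [|exact: tameZ|exact: tameZ].
rewrite !gauss_expZ // => h.
have p1 : gauss_exp i <= 1 by exact: gauss_exp_ind_le1.
have p0 : 0 <= gauss_exp i.
  rewrite -(gauss_exp_cst n 0); apply: gauss_exp_le => [||x]; [exact: tame_cst|exact: gi|].
  by case/andP: (ind_bound (cl K) x).
have nR : 0 <= n%:R :> R by exact: ler0n.
have hA : b * gauss_exp (fun x => i x * sqn x) = b * (n%:R * gauss_exp i) - b * A.
  by rewrite /A; ring.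
have h1 : b * A <= e * `|A|.
  apply: (@le_trans _ _ (b * `|A|)); first by rewrite ler_wpM2l // ler_norm.
  by rewrite ler_wpM2r.
have h2 : n%:R * gauss_exp i * (e - b) <= n%:R * (2 * e ^+ 2).
  apply: (@le_trans _ _ (n%:R * gauss_exp i * (2 * e ^+ 2))).
    by rewrite ler_wpM2l // mulr_ge0.
  rewrite ler_wpM2r //; first by rewrite mulr_ge0 // sqr_ge0.
  by rewrite -[leRHS]mulr1 ler_wpM2l.
lra.
Qed.

End Shrink.
End Shrinking.

(** * Choice of the constants and conclusion *)

Section Final.
Variable R : realType.
Local Notation rV n := 'rV[R]_n.

Lemma cvx_convex_set n (K : set (rV n)) :
  convex_set (K : set (convex_lmodType 'rV[R]_n)) -> cvx K.
Proof.
move=> cK x y l l0 l1 Kx Ky.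
have := cK x y (Itv01 l0 l1); rewrite !inE => /(_ Kx Ky).
by [].
Qed.

Lemma Weq_cl n (K : set (rV n)) j : cvx K -> Weq (pm1 K) j = Weq (pm1 (cl K)) j.
Proof. by move=> cK; apply: eq_bigr => S _; rewrite hcoef_cl. Qed.

(** Here S = sqrt n and 1 / k is the radius of the ball. The factor 16 k in N makes the left side
    exactly (e / (2 k))^2, and e / 2 <= 1 - l. *)
Lemma shrink_steps (S M k N e l : R) : 1 <= S -> 1 <= M -> 1 <= k ->
  N = 16 * k * M * S ^+ 4 -> e = (M * S ^+ 3)^-1 -> l <= 1 - e / 2 ->
  4 / N ^+ 2 * (16 * S ^+ 2) <= ((1 - l) * k^-1) ^+ 2.
Proof.
move=> S1 M1 k1 -> eE le.
have S0 : 0 < S by lra.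
have M0 : 0 < M by lra.
have k0 : 0 < k by lra.
have e0 : 0 < e by rewrite eE invr_gt0 mulr_gt0 // exprn_gt0.
have -> : 4 / (16 * k * M * S ^+ 4) ^+ 2 * (16 * S ^+ 2) = (e / 2 * k^-1) ^+ 2.
  by rewrite eE; field; rewrite !gt_eqF.
have ki : 0 <= k^-1 by rewrite invr_ge0 ltW.
have l0 : e / 2 <= 1 - l by lra.
have e2 : 0 <= e / 2 by lra.
have h1 : 0 <= e / 2 * k^-1 by rewrite mulr_ge0.
have h : e / 2 * k^-1 <= (1 - l) * k^-1 by rewrite ler_wpM2r.
by rewrite ler_pXn2r // nnegrE //; exact: le_trans h.
Qed.

(** Multiplying the loss d by M S^4 removes the dimension: D is at least 1 / (16 (16 k + 2)) >= 1 /
    (288 k), but at most 2 / M + a <= (20/13 + 1) / (1000 k), which is smaller. *)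
Lemma shrink_arith (S M k N e d a : R) : 1 <= S -> 1 <= k -> M = 10 * 10 * 13 * k ->
  N = 16 * k * M * S ^+ 4 -> e = (M * S ^+ 3)^-1 -> 0 <= d ->
  1 / 16 <= (N + 2) * d -> d <= 2 * S ^+ 2 * e ^+ 2 + e * (a / S) ->
  a <= (10 * 10 * 10 * k)^-1 -> False.
Proof.
move=> S1 k1 ME NE eE d0 dN dub ak.
have S0 : 0 < S by lra.
have M0 : 0 < M by lra.
have S4 : 1 <= S ^+ 4 by rewrite exprn_ege1.
have MS4 : 1 <= M * S ^+ 4.
  by have := ler_pM (@ler01 R) (@ler01 R) (_ : 1 <= M) S4; rewrite mulr1; apply; lra.
pose D := d * (M * S ^+ 4).
have dD : d <= D by rewrite ler_peMr.
have D16 : 1 / 16 <= (16 * k + 2) * D.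
  apply: (le_trans dN); rewrite NE [leLHS]mulrDl [leRHS]mulrDl lerD //; last by rewrite ler_wpM2l.
  by rewrite /D le_eqVlt; apply/orP; left; apply/eqP; ring.
have DU : D <= 2 / M + a.
  have : D <= (2 * S ^+ 2 * e ^+ 2 + e * (a / S)) * (M * S ^+ 4).
    by rewrite ler_wpM2r //; exact: le_trans MS4.
  have -> // : (2 * S ^+ 2 * e ^+ 2 + e * (a / S)) * (M * S ^+ 4) = 2 / M + a.
  by rewrite eE; field; rewrite !gt_eqF.
have {}DU : D * (10 * 10 * 10 * k) <= 20 / 13 + 1.
  have k0 : 0 < 10 * 10 * 10 * k by clear - k1; lra.
  apply: (@le_trans _ _ ((2 / M + a) * (10 * 10 * 10 * k))); first exact: (ler_wpM2r (ltW k0) DU).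
  have -> : (2 / M + a) * (10 * 10 * 10 * k) = 20 / 13 + a * (10 * 10 * 10 * k).
    by rewrite ME; field; rewrite gt_eqF //; clear - k1; lra.
  by rewrite lerD2l -ler_pdivlMr ?k0 // div1r.
have Dk : D <= D * k by rewrite ler_peMr //; clear - d0 dD; lra.
clear - D16 DU Dk; lra.
Qed.

(** The quantity bounded below is the rate at which exp(-t) K loses Gaussian measure at t = 0. The
    inverse radius k is an integer so that N = 16 k M n^2 is one. *)
Lemma laplacian_lower_bound n (K : set (rV n)) (k0 : nat) (k := k0%:R : R)
    (p := gauss_exp (ind (cl K))) :
  cvx K -> (0 < n)%N -> (0 < k0)%N -> `|2 * p - 1| <= 1 / 100 ->
  (forall z, sqn z <= k^-1 ^+ 2 -> cl K z) ->
  (10 * 10 * 10 * k)^-1 / Num.sqrt n%:R <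
    `|n%:R * p - gauss_exp (fun x => ind (cl K) x * sqn x)|.
Proof.
move=> cK n0 k00 p2 ballK; rewrite ltNge; apply/negP => A2.
have nR : 0 < n%:R :> R by rewrite ltr0n.
pose S : R := Num.sqrt n%:R; rewrite -/S in A2.
have nS : n%:R = S ^+ 2 by rewrite sqr_sqrtr // (ltW nR).
have S1 : 1 <= S by rewrite -[leLHS]sqrtr1 ler_sqrt ?(ltW nR) // ler1n.
have k1 : 1 <= k by rewrite /k ler1n.
have [m mE] : exists m : nat, m%:R = 10 * 10 * 13 * k.
  by exists (10 * 10 * 13 * k0)%N; rewrite !natrM.
have [N NE] : exists N : nat, N%:R = 16 * k * m%:R * S ^+ 4.
  exists (16 * k0 * m * n ^ 2)%N; rewrite !natrM nS /k; ring.
clearbody S k; set M := m%:R in mE NE.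
have M1 : 4 <= M by rewrite mE; lra.
have S0 : 0 < S by lra.
have S4 : 1 <= S ^+ 4 by rewrite exprn_ege1.
have S3 : 1 <= S ^+ 3 by rewrite exprn_ege1.
have M0 : 0 < M by lra.
have N0 : (0 < N)%N.
  by rewrite -(ltr0n R) NE !mulr_gt0 // ?exprn_gt0 //; lra.
pose e := (M * S ^+ 3)^-1.
have MS3 : 4 <= M * S ^+ 3.
  have : 4 * 1 <= M * S ^+ 3 by apply: ler_pM.
  by rewrite mulr1.
have e0 : 0 < e by rewrite invr_gt0; apply: lt_le_trans MS3.
have e4 : e <= 1 / 4 by rewrite /e div1r lef_pV2 ?posrE //; apply: lt_le_trans MS3.
pose l := expR (- e).
have l0 : 0 < l by exact: expR_gt0.
have l1 : l <= 1 - e / 2.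
  have : expR e * l = 1 by rewrite -expRD subrr expR0.
  have := expR_ge1Dx e; set x := expR e => h1 h2.
  have : (1 + e) * l <= x * l by rewrite ler_wpM2r // (ltW l0).
  rewrite h2; clear - e0 e4 l0; clearbody e l; nra.
have l01 : 0 < l < 1.
  by rewrite l0 /=; clear - l1 e0; clearbody l e; lra.
have hN : 4 / N%:R ^+ 2 * (16 * n%:R) <= ((1 - l) * k^-1) ^+ 2.
  rewrite nS; apply: (shrink_steps S1 _ k1 NE (erefl e) l1).
  by apply: le_trans M1; rewrite ler1n.
pose q := gauss_exp (fun x => ind (cl K) (l^-1 *: x)).
have iso := shrink_isoperimetry cK l01 ballK N0 n0 hN.
have shr := shrink_measure_ge K l01 (erefl l) e0 e4.
rewrite -/p -/q in iso shr.
pose d := p - q; rewrite -/d in iso shr.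
have d0 : 0 <= d.
  rewrite subr_ge0; apply: gauss_exp_le; [exact: tame_iL|exact: tame_ind1|].
  by move=> x; exact: (shrink_le cK l01 ballK).
have q0 : 0 <= q.
  rewrite -(gauss_exp_cst n 0); apply: gauss_exp_le; [exact: tame_cst|exact: tame_iL|].
  by move=> x; have /andP[] := ind_bound (cl K) (l^-1 *: x).
(* As p (1 - p) >= 3/16 and q = p - d, q (1 - q) >= 3/16 - 2 d; this is the origin of the 2, and
   3/16 - 1/8 = 1/16. *)
have dN : 1 / 16 <= (N%:R + 2) * d.
  have qE : q = p - d by rewrite /d; ring.
  move: iso q0 p2; rewrite qE; clear - d0; clearbody d p; move: N%:R => Nr.
  rewrite ler_norml => iso q0 /andP[pb1 pb2].
  have d1 : d <= 1 by lra.
  have dd : d ^+ 2 <= d by nra.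
  have pp : 3 / 16 <= p * (1 - p) by nra.
  have : (p - d) * (1 - (p - d)) = p * (1 - p) + d * (2 * p - 1) - d ^+ 2 by ring.
  have : - d <= d * (2 * p - 1) by nra.
  lra.
apply: (shrink_arith S1 k1 mE NE (erefl e) d0 dN _ (lexx _)).
by rewrite -nS; apply: (le_trans shr); rewrite lerD2l ler_wpM2l // (ltW e0).
Qed.

Lemma Wle2_lower_bound n (K : set (rV n)) : cvx K -> (0 < n)%N ->
  ((10 * 10 * 10 * (10 * 10 * 10))^-1 / n%:R) ^+ 2 <= Wle (pm1 (cl K)) 2.
Proof.
move=> cK n0.
have kE : (10 * 10 * 10)%N%:R = 10 * 10 * 10 :> R by rewrite !natrM.
have := @laplacian_lower_bound n K (10 * 10 * 10) cK n0 isT; rewrite kE.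
have k0 : (1 / 1000 : R) = (10 * 10 * 10)^-1 by field.
have eta1 : (10 * 10 * 10 * (10 * 10 * 10))^-1 <= 1 / 1000 :> R by lra.
have eta0 : 0 < (10 * 10 * 10 * (10 * 10 * 10))^-1 :> R by lra.
(* The radius is 1 / k = 1/1000, and eta = 1 / (1000 k) is the constant in the lower bound to be
   contradicted; it is also small enough for the separation argument. *)
move: eta0 eta1 k0; set eta := (_ * (10 * 10 * 10))^-1; clearbody eta.
set k := 10 * 10 * 10; clearbody k; move=> eta0 eta1 k0 bound.
rewrite leNgt; apply/negP.
have nR : 0 < n%:R :> R by rewrite ltr0n.
have en0 : 0 < eta / n%:R by rewrite divr_gt0.
have en : eta / n%:R <= eta.
  rewrite ler_pdivrMr //; have : 1 <= n%:R :> R by rewrite ler1n.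
  by move=> h; rewrite ler_peMr // (ltW eta0).
rewrite WleE; set f := pm1 (cl K); set T := (_ / _) ^+ 2 => small.
have [W0 W1 W2] : [/\ Weq f 0 < T, Weq f 1 < T & Weq f 2 < T].
  have := Weq_ge0 f 0; have := Weq_ge0 f 1; have := Weq_ge0 f 2.
  by move: small; clear; split; lra.
have absb h : h ^+ 2 < T -> `|h| <= eta / n%:R.
  move=> hT; rewrite -(@ler_pXn2r _ 2) ?nnegrE ?(ltW en0) //.
  by rewrite real_normK ?num_real //; exact: ltW.
pose i := ind (cl K); pose p := gauss_exp i.
have p2 : `|2 * p - 1| <= eta.
  apply: le_trans en; apply: absb.
  by apply: le_lt_trans W0; rewrite Weq0E hcoef_0.
have half (a b : R) : `|2 * a| <= b -> `|a| <= b.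
  rewrite normrM ger0_norm // => h; apply: le_trans h.
  by rewrite ler_peMl // ler1n.
have H1 j : `|gauss_exp (fun x => ind (cl K) x * x 0 j)| <= eta / n%:R.
  by have := absb _ (le_lt_trans (hcoef_le_Weq1 f j) W1); rewrite hcoef_1 => /half.
have H2 j l : `|gauss_exp (fun x => ind (cl K) x * (x 0 j * x 0 l)) - (j == l)%:R * p| <= eta / n%:R.
  have := absb _ (le_lt_trans (hcoef_le_Weq2 f j l) W2).
  case: (eqVneq j l) => [<-|jl].
    rewrite hcoef_2 mul1r -/i -/p normrM ger0_norm ?sqrtr_ge0 //.
    have : 1 <= Num.sqrt 2 :> R by rewrite -[leLHS]sqrtr1 ler_sqrt // ler1n.
    by move=> h1; apply: le_trans; rewrite ler_peMl.
  by rewrite hcoef_11 // mul0r subr0 => /half.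
have p49 : 49 / 100 <= p.
  by move: p2 eta1; clear; clearbody p; rewrite ler_norml => /andP[]; lra.
have ballK z : sqn z <= k^-1 ^+ 2 -> cl K z.
  by rewrite -k0; exact: (short_vector_in_cl cK (erefl p) p49 eta1 H1 H2).
pose A := n%:R * p - gauss_exp (fun x => i x * sqn x).
have AE : \sum_j hcoef f (fun k => (k == j) + (k == j))%N = - Num.sqrt 2 * A.
  under eq_bigr do rewrite hcoef_2 -/i -/p.
  rewrite -mulr_sumr sumrB sumr_const card_ord -gauss_exp_sum; last first.
    by move=> j; apply/tame_ind/tame_coordM.
  have -> : (fun x => \sum_j i x * (x 0 j * x 0 j)) = fun x => i x * sqn x.
    by apply/funext => x; rewrite mulr_sumr; apply: eq_bigr => j _; rewrite expr2.
  by rewrite /A mulNr -mulrN opprB mulr_natl.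
pose S : R := Num.sqrt n%:R.
have nS : n%:R = S ^+ 2 by rewrite sqr_sqrtr // (ltW nR).
have S0 : 0 < S by rewrite sqrtr_gt0.
(* Cauchy-Schwarz over the n coefficients at 2 e_j: 2 A^2 <= n (eta / n)^2 = (eta / S)^2. *)
have A2 : `|A| <= eta / S.
  have s2 : Num.sqrt 2 ^+ 2 = 2 :> R by rewrite sqr_sqrtr.
  have h1 := sqr_sum_le (fun j => hcoef f (fun k => (k == j) + (k == j))%N).
  rewrite AE exprMn sqrrN s2 in h1.
  have h3 : 2 * A ^+ 2 <= n%:R * T.
    apply: (le_trans h1); rewrite (ler_wpM2l (ltW nR)) //.
    by apply: (le_trans (sum_hcoef_le_Weq2 f)); exact: ltW.
  have h4 : n%:R * T = (eta / S) ^+ 2.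
    by rewrite /T nS; clear - S0; clearbody S; field; rewrite gt_eqF.
  rewrite -(@ler_pXn2r _ 2) ?nnegrE ?divr_ge0 ?(ltW eta0) ?(ltW S0) //.
  rewrite real_normK ?num_real // -h4; apply: le_trans h3.
  by rewrite ler_peMl ?sqr_ge0 // ler1n.
have : `|2 * p - 1| <= 1 / 100.
  by apply: (le_trans p2); move: eta1; clear; lra.
by move=> /bound /(_ ballK); rewrite -/p -/i -/A -/S ltNge => /negP.
Qed.

End Final.

Theorem theorem1p7 (R : realType) :
  exists c : R, 0 < c /\
    forall (n : nat) (K : set 'rV[R]_n),
      convex_set (K : set (convex_lmodType 'rV[R]_n)) ->
      Wle (pm1 K) 2 = Weq (pm1 K) 0 + Weq (pm1 K) 1 + Weq (pm1 K) 2 /\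
      Wle (pm1 K) 2 >= c / (n%:R ^+ 2).
Proof.
exists ((10 * 10 * 10 * (10 * 10 * 10))^-1 ^+ 2); split.
  by rewrite exprn_gt0 // invr_gt0; lra.
move=> n K /cvx_convex_set cK; split; first exact: WleE.
have WE : Wle (pm1 K) 2 = Wle (pm1 (cl K)) 2 by rewrite !WleE !(Weq_cl _ cK).
rewrite WE; have [n0|n0] := posnP n.
  (* In dimension 0 the bound reads c / 0 = 0, by the convention on inverses, and only nonnegativity
     remains. *)
  have -> : n%:R = 0 :> R by rewrite n0.
  by rewrite expr0n invr0 mulr0 WleE !addr_ge0 // Weq_ge0.
by rewrite -expr_div_n; exact: Wle2_lower_bound.
Qed.
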